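(* In the setting described in the context, let $\tau>0$, let $S:X\to\mathbb{R}^{n_s}$ and $C:\mathbb{R}^{n_a}\to X$ be linear maps and assume $$\operatorname{rank}(SH_* )=b_1,\qquad \operatorname{rank}(H_*^\top W_*^{-1}C)=b_1 .$$ Then, for every $\kappa>0$, there exists a linear map $K:\mathbb{R}^{n_s}\to\mathbb{R}^{n_a}$ such that $$L_{HH}:=H_*^\top W_*^{-1}CKSH_*=-\kappa I_{b_1}.\qquad( * )$$ In the minimal square case $n_a=n_s=b_1$, this gain is unique for fixed $S$ and $C$ and is given by $$K=-\kappa(H_*^\top W_*^{-1}C)^{-1}(SH_* )^{-1}.$$ For every gain $K$ satisfying $( * )$, the harmonic coordinate $h=H_*^\top W_*^{-1}r$ of every solution of the finite-channel tangent system $$\dot\vartheta=\nu,\qquad M\dot\nu=-D\nu-Br,\qquad\tau\dot w=W_*^{-1}CKSr,\qquad r=W_*B^\top\vartheta+W_*w,$$ with $(\vartheta,\nu,w)\in\mathbb{R}^n\times\mathbb{R}^n\times X$, obeys $$\tau\dot h=-\kappa h+L_{HC}r_C,\qquad r_C=P_C^{W_*}r,\quad L_{HC}:=H_*^\top W_*^{-1}CKS\big|_{\mathcal{C}_*}.$$ Consequently, for every such gain, the following hold. (i) The law $h(t)=e^{-(\kappa/\tau)t}h(0)$ holds for every solution of the tangent system if and only if $L_{HC}=0$, equivalently $H_*^\top W_*^{-1}CKSP_C^{W_*}=0$. A sufficient condition is $SP_C^{W_*}=0$. (ii) Quotient the phase deviation by the uniform phase-shift direction and restrict the actuator deviation to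 the invariant subspace $\operatorname{im}(W_*^{-1}C)$; denote the resulting reduced tangent state by $$z_{\rm red}:=([\vartheta],\nu,w)\in\bigl(\mathbb{R}^n/\operatorname{span}\{\mathbf{1}_V\}\bigr)\times\mathbb{R}^n\times\operatorname{im}(W_*^{-1}C),$$ and let $\mathcal{A}_{\rm red}(S,C,K)$ denote the matrix of its linear dynamics in any fixed coordinates. If $s(\mathcal{A}_{\rm red}(S,C,K))<0$, where $s(\cdot)$ is the spectral abscissa, then there exist constants $M_0\ge1$ and $\mu>0$ such that $$\|z_{\rm red}(t)\|\le M_0e^{-\mu t}\|z_{\rm red}(0)\|\qquad(t\ge0).$$ That is, for all such reduced-state trajectories, $$\inf_{c\in\mathbb{R}}\|\vartheta(t)-c\mathbf{1}_V\|\to0,\qquad \nu(t)\to0,\qquad w(t)\to0\qquad(t\to\infty),$$ and consequently $r(t)\to0$, $r_C(t)\to0$, $h(t)\to0$. The harmonic output may nevertheless contain the cut-forced transient in $$h(t)=e^{-(\kappa/\tau)t}h(0)+\frac1\tau\int_0^te^{-(\kappa/\tau)(t-s)}L_{HC}r_C(s)\,ds,$$ and need not follow $h(t)=e^{-(\kappa/\tau)t}h(0)$ during the transient.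
   Context: $G=(V,E)$ is a finite connected graph with $n=|V|$, $m=|E|$, a fixed orientation of each edge, edge space $X=\mathbb{R}^E\cong\mathbb{R}^m$, and incidence matrix $B:X\to\mathbb{R}^n$ whose column for each oriented edge has entry $+1$ at the tail and $-1$ at the head; $b_1=m-n+1=\dim\ker B$; $\mathbf{1}_V\in\mathbb{R}^n$ is the all-ones vector. $M,D\in\mathbb{R}^{n\times n}$ are positive diagonal. Operating point: for line coefficients $a_e>0$ and $\theta_*\in\mathbb{R}^n$, $u_*\in X$, put $\eta_*=B^\top\theta_*+u_*$ and assume angle-cohesiveness: for some $0<\gamma<\pi/2$, $|\operatorname{pr}(\eta_{*,e})|\le\gamma$ for all $e\in E$, where $\operatorname{pr}(x)\in[-\pi,\pi)$ is the representative of $x$ modulo $2\pi$. Then $W_*=\operatorname{diag}\bigl(a_e\cos(\operatorname{pr}(\eta_{*,e}))\bigr)$ is positive diagonal. Weighted projections: $H_*:\mathbb{R}^{b_1}\to X$ is a linear map whose columns form a basis of $\ker B$ with $H_*^\top W_*^{-1}H_*=I_{b_1}$; $P_H^{W_*}=H_*H_*^\top W_*^{-1}$ is the $W_*^{-1}$-orthogonal projection onto $\ker B$, and $P_C^{W_*}=I-P_H^{W_*}$ is the projection onto the weighted cut space $\mathcal{C}_*=\operatorname{im}(W_*B^\top)=(\ker B)^{\perp_{W_*^{-1}}}$ (orthogonality for $x^\top W_*^{-1}y$). The tangent system is the linearization at $(\theta_*,0,u_* )$ of $\dot\theta=\omega$, $M\dot\omega=p-D\omega-Bf(\theta,u)$,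 $\tau\dot u=W_*^{-1}CKS(f(\theta,u)-f_* )$ with $f(\theta,u)=\operatorname{diag}(a)\sin(B^\top\theta+u)$, $f_*=f(\theta_*,u_* )$, $p=Bf_*$. The tangent system is invariant under $\vartheta\mapsto\vartheta+c\mathbf{1}_V$ (as $B^\top\mathbf{1}_V=0$), and $\dot w\in\operatorname{im}(W_*^{-1}C)$, so the reduced dynamics in (ii) is well defined. The spectral abscissa of a matrix is the maximum of the real parts of its eigenvalues. *)

(* Defs.v *)
From HB Require Import structures.
From mathcomp Require Import all_boot all_order all_algebra.
From mathcomp Require Import all_classical all_reals all_analysis.
From mathcomp Require Import complex.

Set Implicit Arguments.
Unset Strict Implicit.
Unset Printing Implicit Defensive.

Import Order.TTheory GRing.Theory Num.Theory.
Import numFieldNormedType.Exports.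

Local Open Scope classical_set_scope.
Local Open Scope ring_scope.

(* V = 'I_n, E = 'I_m; edge e is oriented from [edge_tail e] to [edge_head e].
   Parallel edges are allowed, loops are excluded in [network_ok]. *)
Record network (R : realType) (n m : nat) := Network {
  edge_tail : 'I_m -> 'I_n;
  edge_head : 'I_m -> 'I_n;
  mass : 'M[R]_n;
  damping : 'M[R]_n;
  line_coef : 'I_m -> R;
  theta_op : 'cV[R]_n;
  u_op : 'cV[R]_m }.

(* b_1 = m - n + 1, arranged so that truncated subtraction is harmless when
   m = n - 1 (trees). *)
Definition b1 (n m : nat) : nat := (m + 1 - n)%N.

Definition pos_diag (R : realType) (n : nat) (A : 'M[R]_n) : Prop :=
  is_diag_mx A /\ forall i, 0 < A i i.

(* The representative of x modulo 2 pi in [-pi, pi). *)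
Definition pr (R : realType) (x : R) : R :=
  x - (Num.floor ((x + pi) / (pi *+ 2)))%:~R * (pi *+ 2).

Definition enorm (R : realType) (k : nat) (x : 'cV[R]_k) : R :=
  Num.sqrt (\sum_i x i 0 ^+ 2).

Definition im_mx (R : realType) (k l : nat) (A : 'M[R]_(k, l)) :
    {vspace 'cV[R]_k} :=
  limg (linfun (mulmx A : 'cV[R]_l -> 'cV[R]_k)).

Definition ker_mx (R : realType) (k l : nat) (A : 'M[R]_(k, l)) :
    {vspace 'cV[R]_l} :=
  lker (linfun (mulmx A : 'cV[R]_l -> 'cV[R]_k)).

(* The complex eigenvalues form a finite set, nonempty when 0 < N, so the
   supremum is then a maximum. *)
Definition spectral_abscissa (R : realType) (N : nat) (A : 'M[R]_N) : R :=
  sup [set complex.Re z | z in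
        [set z : R[i] | eigenvalue (map_mx (real_complex R) A) z]].

Section Network.
Context {R : realType} {n m : nat} (net : network R n m).

Definition adjacent : rel 'I_n := fun x y =>
  [exists e, ((edge_tail net e == x) && (edge_head net e == y))
             || ((edge_tail net e == y) && (edge_head net e == x))].

Definition connected_graph : Prop :=
  (0 < n)%N /\ forall x y, connect adjacent x y.

(* No two distinct edges join the same pair of vertices. *)
Definition simple_graph : Prop :=
  injective (fun e => [set edge_tail net e; edge_head net e]%SET).

Definition incidence : 'M[R]_(n, m) :=
  \matrix_(i, e) ((i == edge_tail net e)%:R - (i == edge_head net e)%:R).

Local Notation B := incidence.

Definition eta_op : 'cV[R]_m := B^T *m theta_op net + u_op net.

Definition angle_cohesive : Prop :=
  exists gamma : R, [/\ 0 < gamma, gamma < pi / 2 &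
    forall e, `|pr (eta_op e 0)| <= gamma].

Definition network_ok : Prop :=
  [/\ forall e, edge_tail net e != edge_head net e,
      connected_graph,
      pos_diag (mass net) /\ pos_diag (damping net),
      forall e, 0 < line_coef net e
    & angle_cohesive].

Definition Wop : 'M[R]_m :=
  diag_mx (\row_e (line_coef net e * cos (pr (eta_op e 0)))).

Local Notation W := Wop.

Definition harmonic_basis (H : 'M[R]_(m, b1 n m)) : Prop :=
  basis_of (ker_mx B) [seq col j H | j <- enum 'I_(b1 n m)]
  /\ H^T *m invmx W *m H = 1%:M.

Definition P_H (H : 'M[R]_(m, b1 n m)) : 'M[R]_m := H *m H^T *m invmx W.
Definition P_C (H : 'M[R]_(m, b1 n m)) : 'M[R]_m := 1%:M - P_H H.

Definition cut_space : {vspace 'cV[R]_m} := im_mx (W *m B^T).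

(* r = W B^T vartheta + W w *)
Definition flow (th : 'cV[R]_n) (w : 'cV[R]_m) : 'cV[R]_m :=
  W *m B^T *m th + W *m w.

Definition harmonic_coord (H : 'M[R]_(m, b1 n m)) (r : 'cV[R]_m) :
    'cV[R]_(b1 n m) :=
  H^T *m invmx W *m r.

Section Channels.
Context {ns na : nat}.
Implicit Types (H : 'M[R]_(m, b1 n m)) (S : 'M[R]_(ns, m)) (C : 'M[R]_(m, na))
  (K : 'M[R]_(na, ns)).

Definition L_HH H S C K : 'M[R]_(b1 n m) :=
  H^T *m invmx W *m C *m K *m S *m H.

Definition tuned_gain H S C (kappa : R) K : Prop :=
  L_HH H S C K = - kappa *: 1%:M.

(* The matrix whose restriction to the cut space is L_HC. *)
Definition L_H H S C K : 'M[R]_(b1 n m, m) := H^T *m invmx W *m C *m K *m S.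

Definition L_HC H S C K : 'Hom(subvs_of cut_space, 'cV[R]_(b1 n m)) :=
  linfun ((mulmx (L_H H S C K) : 'cV[R]_m -> _)
          \o (vsval : subvs_of cut_space -> 'cV[R]_m)).

(* L_HC r_C for r_C = P_C r; [vsproj] only turns the vector P_C r, which lies
   in the cut space, into an element of the corresponding subtype. *)
Definition cut_forcing H S C K (r : 'cV[R]_m) : 'cV[R]_(b1 n m) :=
  L_HC H S C K (vsproj cut_space (P_C H *m r)).

(* Solutions on [0, +oo[: continuous up to the initial time 0 and satisfying
   the equations at every t > 0. *)
Definition tangent_solution (tau : R) S C K
    (th nu : R -> 'cV[R]_n) (w : R -> 'cV[R]_m) : Prop :=
  [/\ derivable_oy_Rcontinuous th 0,
      derivable_oy_Rcontinuous nu 0,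
      derivable_oy_Rcontinuous w 0
    & forall t : R, 0 < t ->
      [/\ derive1 th t = nu t,
          mass net *m derive1 nu t
            = - (damping net *m nu t) - B *m flow (th t) (w t)
        & tau *: derive1 w t = invmx W *m C *m K *m S *m flow (th t) (w t)]].

Definition harmonic_law (tau : R) H S C K (kappa : R) : Prop :=
  forall (th nu : R -> 'cV[R]_n) (w : R -> 'cV[R]_m),
    tangent_solution tau S C K th nu w ->
    forall t : R, 0 <= t ->
      harmonic_coord H (flow (th t) (w t))
      = expR (- (kappa / tau) * t) *: harmonic_coord H (flow (th 0) (w 0)).

Definition actuator_space C : {vspace 'cV[R]_m} := im_mx (invmx W *m C).

(* A reduced trajectory is the class ([th], nu, w) of a tangent solution whose
   actuator component stays in im (W^-1 C). *)
Definition reduced_trajectory (tau : R) S C K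
    (th nu : R -> 'cV[R]_n) (w : R -> 'cV[R]_m) : Prop :=
  tangent_solution tau S C K th nu w
  /\ forall t : R, 0 <= t -> w t \in actuator_space C.

(* Matrix of the tangent system on the stacked state (vartheta, nu, w). *)
Definition tangent_mx (tau : R) S C K : 'M[R]_(n + (n + m)) :=
  let G := W *m B^T in
  let L := tau^-1 *: (invmx W *m C *m K *m S) in
  col_mx (row_mx 0 (row_mx 1%:M 0))
 (col_mx (row_mx (- (invmx (mass net) *m B *m G))
            (row_mx (- (invmx (mass net) *m damping net))
                    (- (invmx (mass net) *m B *m W))))
         (row_mx (L *m G) (row_mx 0 (L *m W)))).

Definition in_restricted C (x : 'cV[R]_(n + (n + m))) : Prop :=
  dsubmx (dsubmx x) \in actuator_space C.

Definition uniform_shift : 'cV[R]_(n + (n + m)) := col_mx (const_mx 1) 0.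

(* Linear coordinates on (R^n / span 1) x R^n x im (W^-1 C), given as a linear
   map on stacked states: [Phi *m x] is the coordinate vector of the class of
   x. The two clauses say that Phi induces a bijection from the quotient of
   the restricted states by the uniform shift onto R^N. *)
Definition reduced_coordinates C (N : nat) (Phi : 'M[R]_(N, n + (n + m))) :
    Prop :=
  (forall z : 'cV[R]_N, exists2 x, in_restricted C x & Phi *m x = z)
  /\ (forall x, in_restricted C x ->
        (Phi *m x = 0 <-> exists c : R, x = c *: uniform_shift)).

(* A is the matrix of the reduced dynamics in the coordinates Phi; it exists
   and is unique because the tangent system descends to the quotient. *)
Definition reduced_matrix (tau : R) S C K (N : nat)
    (Phi : 'M[R]_(N, n + (n + m))) (A : 'M[R]_N) : Prop :=
  forall x, in_restricted C x ->
    A *m (Phi *m x) = Phi *m (tangent_mx tau S C K *m x).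

End Channels.

Definition phase_norm (th : 'cV[R]_n) : R :=
  inf [set enorm (th - c *: const_mx 1) | c in [set: R]].

(* Euclidean product norm of the reduced state ([th], nu, w), with the quotient
   norm in the first component. *)
Definition reduced_norm (th nu : 'cV[R]_n) (w : 'cV[R]_m) : R :=
  Num.sqrt (phase_norm th ^+ 2 + enorm nu ^+ 2 + enorm w ^+ 2).

End Network.

(* Main.v *)
Require Import Defs.
From HB Require Import structures.
From mathcomp Require Import all_boot all_order all_algebra.
From mathcomp Require Import all_classical all_reals all_analysis.
From mathcomp Require Import complex ring lra.

Set Implicit Arguments.
Unset Strict Implicit.
Unset Printing Implicit Defensive.

Import Order.TTheory GRing.Theory Num.Theory.
Import numFieldNormedType.Exports.

Local Open Scope classical_set_scope.
Local Open Scope ring_scope.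

(** Write [r = P_H r + P_C r], where the projections are orthogonal for
    [invmx W]. Phase differences [W B^T theta] are orthogonal to [ker B], so the
    harmonic coordinate of a flow is [H^T w] and its derivative is
    [L_H r / tau]. A tuned gain acts as [- kappa] on the part of [r] in
    [ker B], and what remains is the forcing by the cut part; this is the
    harmonic equation ([harmonic_split], [harmonic_equation]). Gains exist
    because the rank conditions give [H^T W^-1 C] a right inverse and [S H] a
    left inverse, and in the square case both are inverses.

    Variation of constants ([variation_of_constants]) turns the harmonic
    equation into the integral formula, which becomes the exponential law when
    the cut forcing vanishes identically. Conversely, the exponential law makes
    the cut forcing vanish along every solution, and by the exponential series
    ([linear_flow_exists]) there is a solution through every initial state; the
    flows of the states [(theta, 0, 0)] fill the cut space.

    For the stability statement, a matrix with all its eigenvalues in the open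
    left half-plane has a quadratic Lyapunov form
    ([lyapunov_of_eigenvalues]). The form is built over the reals, one pair of
    conjugate eigenvalues at a time: the quadratics
    [(X - Re z)^2 + (Im z)^2], for [z] running over the eigenvalues, multiply
    to the square of the characteristic polynomial, which annihilates the
    matrix, and removing one quadratic amounts to estimating a damped
    oscillator driven by a vector that already decays ([lyapunov_step]). The
    resulting decay of the reduced coordinates is carried over to the reduced
    norm, which is equivalent to the norm of the coordinates:
    [sqn_mulmx_le_reduced] is the bound from above, and a linear section of the
    coordinate map gives the bound from below ([reduced_sqn_le]).

    The transient is exhibited on a triangle with unit weights, damping 4, one
    actuator producing a circulation and one sensor on a single line. The
    whole state can then decay like [expR (-3 t)], while the exponential law
    asks the harmonic coordinate to decay like [expR (- t)]. *)

(** * Limits and derivatives of matrix-valued functions *)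

Lemma cvg_mxP {R : realFieldType} {T : Type} {F : set_system T} {FF : Filter F}
    {m n : nat} (f : T -> 'M[R]_(m, n)) (l : 'M[R]_(m, n)) :
  f x @[x --> F] --> l <-> forall i j, f x i j @[x --> F] --> l i j.
Proof.
split=> [fl i j|fl].
- apply/cvgrPdist_le => e e0.
  move/cvgrPdist_le : fl => /(_ _ e0); apply: filterS => x.
  apply: le_trans.
  rewrite [leRHS]/Num.Def.normr/= mx_normrE.
  apply: le_trans; last exact: (le_bigmax _ _ (i, j)).
  by rewrite !mxE.
- apply/cvgrPdist_le => /= e e0; near=> x.
  rewrite [leLHS]/Num.Def.normr/= mx_normrE (bigmax_le _ (ltW e0))//= => i _.
  rewrite !mxE; move: i; near: x; apply: filter_forall => /= i.
  exact: ((cvgrPdist_le _ _).1 (fl i.1 i.2)).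
Unshelve. all: by end_near. Qed.

Lemma cvg_mulmx {R : realFieldType} {T : Type} {F : set_system T}
    {FF : Filter F} {m n p : nat} (A : 'M[R]_(m, n)) (f : T -> 'M[R]_(n, p))
    (l : 'M[R]_(n, p)) :
  f x @[x --> F] --> l -> A *m f x @[x --> F] --> A *m l.
Proof.
move=> /cvg_mxP fl; apply/cvg_mxP => i j; rewrite !mxE.
rewrite (_ : (fun x => _) = \sum_k (fun x => A i k * f x k j)); last first.
  by apply/funext => x; rewrite !mxE fct_sumE.
elim/big_ind2: _ => [|g a h b gf hf|k _]; first exact: cvg_cst.
- exact: cvgD.
- by apply: cvgM; [exact: cvg_cst|exact: fl].
Qed.

Lemma is_derive_mxP {R : realType} {m n : nat} (f : R -> 'M[R]_(m, n))
    (df : 'M[R]_(m, n)) (t : R) :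
  is_derive t 1 f df <-> forall i j, is_derive t 1 (fun x => f x i j) (df i j).
Proof.
split=> [[fd fE] i j|fd].
- have fd' := (derivable_mxP f t 1).1 fd.
  by split=> //; rewrite -fE derive_mx// mxE.
- have fd' : derivable f t 1 by apply/derivable_mxP => i j; exact: ex_derive.
  by split=> //; rewrite derive_mx//; apply/matrixP => i j; rewrite mxE derive_val.
Qed.

Lemma is_derive_mulmx {R : realType} {m n p : nat} (A : 'M[R]_(m, n))
    (f : R -> 'M[R]_(n, p)) (df : 'M[R]_(n, p)) (t : R) :
  is_derive t 1 f df -> is_derive t 1 (fun x => A *m f x) (A *m df).
Proof.
move=> /is_derive_mxP fd; apply/is_derive_mxP => i j; rewrite !mxE.
rewrite (_ : (fun x => _) = \sum_k (fun x => A i k * f x k j)); last first.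
  by apply/funext => x; rewrite !mxE fct_sumE.
by apply: is_derive_sum => k.
Qed.

Lemma is_derive_col_mx {R : realType} {m1 m2 n : nat}
    (f : R -> 'M[R]_(m1, n)) (g : R -> 'M[R]_(m2, n)) df dg (t : R) :
  is_derive t 1 f df -> is_derive t 1 g dg ->
  is_derive t 1 (fun x => col_mx (f x) (g x)) (col_mx df dg).
Proof.
move=> /is_derive_mxP fd /is_derive_mxP gd; apply/is_derive_mxP => i j.
rewrite mxE; under eq_fun do rewrite mxE.
by case: (fintype.split i) => k; [exact: fd|exact: gd].
Qed.

Lemma is_derive_derivable1 {R : realType} {V : normedModType R} (f : R -> V)
    df (t : R) :
  is_derive t 1 f df -> derivable f t 1 /\ derive1 f t = df.
Proof. by case=> fd fE; split=> //; rewrite derive1E. Qed.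

Lemma derivable_oy_is_derive {R : realType} {V : normedModType R} (f : R -> V)
    (t : R) :
  derivable_oy_Rcontinuous f 0 -> 0 < t -> is_derive t 1 f (derive1 f t).
Proof.
move=> [fd _] t0; split; last by rewrite derive1E.
by apply: fd; rewrite in_itv/= t0.
Qed.

Lemma is_derive_derivable_oy {R : realType} {V : normedModType R} (f df : R -> V) :
  f t @[t --> 0^'+] --> f 0 -> (forall t : R, 0 < t -> is_derive t 1 f (df t)) ->
  derivable_oy_Rcontinuous f 0.
Proof.
by move=> f0 fd; split=> // t; rewrite in_itv/= andbT => /fd/is_derive_derivable1[].
Qed.

Lemma is_derive_continuous {R : realType} {V : normedModType R} (f : R -> V)
    df (t : R) :
  is_derive t 1 f df -> {for t, continuous f}.
Proof.
by case=> fd _; apply/differentiable_continuous; rewrite -derivable1_diffP.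
Qed.

Lemma derivable_oy_mulmx {R : realType} k l (A : 'M[R]_(k, l)) (x : R -> 'cV[R]_l) :
  derivable_oy_Rcontinuous x 0 -> derivable_oy_Rcontinuous (fun t => A *m x t) 0.
Proof.
move=> xD; apply: (is_derive_derivable_oy (df := fun t => A *m derive1 x t)).
  by apply: cvg_mulmx; exact: xD.2.
by move=> t t0; apply: is_derive_mulmx; exact: derivable_oy_is_derive.
Qed.

Lemma derivable_oyD {R : realType} {V : normedModType R} (x y : R -> V) :
  derivable_oy_Rcontinuous x 0 -> derivable_oy_Rcontinuous y 0 ->
  derivable_oy_Rcontinuous (fun t => x t + y t) 0.
Proof.
move=> xD yD; split; last by apply: cvgD; [exact: xD.2|exact: yD.2].
by move=> t t0; apply: derivableD; [exact: xD.1|exact: yD.1].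
Qed.

Lemma derivable_oy_entry {R : realType} k (x : R -> 'cV[R]_k) i :
  derivable_oy_Rcontinuous x 0 -> derivable_oy_Rcontinuous (fun t => x t i 0) 0.
Proof.
move=> [xD x0]; split; last exact: ((cvg_mxP _ _).1 x0).
by move=> t /xD xt; exact: ((derivable_mxP x t 1).1 xt i 0).
Qed.

(** * Scalar linear differential equations *)

Lemma is_derive_expR_scale {R : realType} (mu s : R) :
  is_derive s 1 (fun s => expR (mu * s)) (mu * expR (mu * s)).
Proof.
have muD : is_derive s 1 (mu *: (@id R)) (mu *: (1 : R)) by exact: is_deriveZ.
have := @is_derive1_comp R expR (mu *: (@id R)) s _ _ _ muD.
move=> /(_ _ (is_derive_expR _)).
by rewrite /GRing.scale/= mulr1 mulrC; apply.
Qed.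

(** The product [expR (mu * t) * V t] has a nonpositive derivative. *)
Lemma decay_of_diff_ineq {R : realType} (V dV : R -> R) (mu : R) :
  V t @[t --> 0^'+] --> V 0 ->
  (forall t : R, 0 < t -> is_derive t 1 V (dV t)) ->
  (forall t : R, 0 < t -> dV t <= - mu * V t) ->
  forall t : R, 0 <= t -> V t <= expR (- mu * t) * V 0.
Proof.
move=> V0 VD dVle t t0.
pose g (s : R) := expR (mu * s) * V s.
have gD (s : R) : 0 < s ->
    is_derive s 1 g (expR (mu * s) * (dV s + mu * V s)).
  move=> s0; have dVs := VD s s0; have eD := is_derive_expR_scale mu s.
  rewrite (_ : _ * _ = expR (mu * s) *: dV s + V s *: (mu * expR (mu * s))).
    exact: is_deriveM.
  by rewrite /GRing.scale/=; ring.
have g0 : g s @[s --> 0^'+] --> g 0.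
  apply: cvgM => //; apply: cvg_at_right_filter.
  exact: is_derive_continuous (is_derive_expR_scale mu 0).
have gle : g t <= g 0.
  apply: (ler0_derive1_nincry (a := 0)) => //.
  - by move=> s; rewrite in_itv/= andbT => /gD/is_derive_derivable1[].
  - move=> s; rewrite in_itv/= andbT => s0.
    have [_ ->] := is_derive_derivable1 (gD s s0).
    by rewrite pmulr_rle0 ?expR_gt0// -lerBrDr sub0r -mulNr dVle.
  - exact/derivable_oy_Rcontinuous_within_itvcy/(is_derive_derivable_oy g0 gD).
move: gle; rewrite /g mulr0 expR0 mul1r => gle.
by rewrite mulNr expRN ler_pdivlMl ?expR_gt0.
Qed.

(** For fixed [t], the function
    [s |-> expR (- (kappa / tau) * (t - s)) * (tau * h s)] is a primitive of the
    integrand, by the equation for [h]. *)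
Lemma variation_of_constants {R : realType} (h g : R -> R) (kappa tau : R) :
  tau != 0 -> h t @[t --> 0^'+] --> h 0 ->
  (forall t : R, 0 < t -> is_derive t 1 h (tau^-1 * (- kappa * h t + g t))) ->
  {within `[0, +oo[, continuous g} ->
  forall t : R, 0 <= t ->
    h t = expR (- (kappa / tau) * t) * h 0
        + tau^-1 * \int[lebesgue_measure]_(s in `[0, t])
                     (expR (- (kappa / tau) * (t - s)) * g s).
Proof.
move=> tau0 h0 hD gc t; rewrite le_eqVlt => /predU1P[<-|t0].
  by rewrite set_itv1 Rintegral_set1 !mulr0 addr0 expR0 mul1r.
pose k := kappa / tau.
pose e (s : R) := expR (- k * (t - s)).
have eD (s : R) : is_derive s 1 e (k * e s).
  have -> : e = expR (- k * t) \*: (fun s => expR (k * s)).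
    by apply/funext => u; rewrite /e /= /GRing.scale/= -expRD; congr expR; ring.
  have eD := is_derive_expR_scale k s.
  by apply: (is_derive_eq (is_deriveZ _ eD)); rewrite /= /GRing.scale/=; ring.
have ec : continuous e by move=> s; exact: is_derive_continuous (eD s).
pose F s := e s * (tau * h s).
have FD (s : R) : 0 < s -> is_derive s 1 F (e s * g s).
  move=> s0; have eDs := eD s; have hDs := hD s s0.
  have hDs' := is_deriveZ tau hDs.
  apply: (is_derive_eq (is_deriveM eDs hDs')).
  by rewrite /= /GRing.scale/= /k; field.
have F0 : F s @[s --> 0^'+] --> F 0.
  apply: cvgM; first exact/cvg_at_right_filter/ec.
  by apply: cvgM => //; exact: cvg_cst.
have := @continuous_FTC2 _ (fun s => e s * g s) F 0 t t0.
rewrite /Rintegral => ->.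
- rewrite -EFinB/= /F /e subrr subr0 !mulr0 expR0 mul1r -/k.
  by field.
- move=> s; apply: cvgM.
    by apply: continuous_subspaceT s.
  have /continuous_subspaceW : `[0, t]%classic `<=` `[0, +oo[%classic.
    by move=> r/=; rewrite !in_itv/= => /andP[->].
  by move=> /(_ _ g gc s).
- exact: derivable_oy_continuousWoo t0 (lexx 0) (is_derive_derivable_oy F0 FD).
- by move=> s; rewrite in_itv/= => /andP[/FD/is_derive_derivable1[_ ->]].
Qed.

(** * Squared norms and quadratic forms *)

Section quadratic_forms.
Context {R : realType}.

(** Squared Euclidean norms keep all estimates polynomial. *)
Definition sqn (k : nat) (x : 'cV[R]_k) : R := \sum_i x i 0 ^+ 2.

Lemma sqn_ge0 k (x : 'cV[R]_k) : 0 <= sqn x.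
Proof. by apply: sumr_ge0 => i _; rewrite sqr_ge0. Qed.

Lemma sqr_le_sqn k (x : 'cV[R]_k) i : x i 0 ^+ 2 <= sqn x.
Proof.
rewrite /sqn (bigD1 i)//= lerDl; apply: sumr_ge0 => j _; exact: sqr_ge0.
Qed.

Lemma sqn_mulmx_le k l (A : 'M[R]_(k, l)) :
  exists2 c : R, 0 <= c & forall x : 'cV[R]_l, sqn (A *m x) <= c * sqn x.
Proof.
exists (\sum_i (\sum_j `|A i j|) ^+ 2); first by apply: sumr_ge0 => i _; rewrite sqr_ge0.
move=> x; rewrite mulr_suml; apply: ler_sum => i _; rewrite mxE.
have x_le j : `|x j 0| <= Num.sqrt (sqn x).
  by rewrite -sqrtr_sqr ler_wsqrtr// sqr_le_sqn.
have -> : sqn x = Num.sqrt (sqn x) ^+ 2 by rewrite sqr_sqrtr// sqn_ge0.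
rewrite -exprMn -[leLHS]real_normK ?num_real// ler_sqr ?nnegrE//; last first.
  by rewrite mulr_ge0 ?sqrtr_ge0// sumr_ge0.
rewrite mulr_suml; apply: le_trans (ler_norm_sum _ _ _) _.
by apply: ler_sum => j _; rewrite normrM ler_wpM2l.
Qed.

Definition form (k : nat) (P : 'M[R]_k) (x y : 'cV[R]_k) : R :=
  (x^T *m P *m y) 0 0.

Lemma formDl k P (x y z : 'cV[R]_k) : form P (x + y) z = form P x z + form P y z.
Proof. by rewrite /form linearD/= !mulmxDl mxE. Qed.

Lemma formDr k P (x y z : 'cV[R]_k) : form P x (y + z) = form P x y + form P x z.
Proof. by rewrite /form !mulmxDr mxE. Qed.

Lemma formZl k P a (x y : 'cV[R]_k) : form P (a *: x) y = a * form P x y.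
Proof. by rewrite /form linearZ/= -!scalemxAl mxE. Qed.

Lemma formZr k P a (x y : 'cV[R]_k) : form P x (a *: y) = a * form P x y.
Proof. by rewrite /form -!scalemxAr mxE. Qed.

Lemma form_mxD k P Q (x y : 'cV[R]_k) : form (P + Q) x y = form P x y + form Q x y.
Proof. by rewrite /form mulmxDr mulmxDl mxE. Qed.

Lemma form_mxZ k a P (x y : 'cV[R]_k) : form (a *: P) x y = a * form P x y.
Proof. by rewrite /form -scalemxAr -scalemxAl mxE. Qed.

Lemma form_mulmx k l (P : 'M[R]_k) (Q : 'M[R]_(k, l)) (x y : 'cV[R]_l) :
  form (Q^T *m P *m Q) x y = form P (Q *m x) (Q *m y).
Proof. by rewrite /form trmx_mul !mulmxA. Qed.

Lemma form1E k (x y : 'cV[R]_k) : form 1%:M x y = \sum_i x i 0 * y i 0.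
Proof. by rewrite /form mulmx1 mxE; apply: eq_bigr => i _; rewrite mxE. Qed.

Lemma form1_sqn k (x : 'cV[R]_k) : form 1%:M x x = sqn x.
Proof. by rewrite form1E; apply: eq_bigr => i _; rewrite expr2. Qed.

Lemma form1C k (x y : 'cV[R]_k) : form 1%:M x y = form 1%:M y x.
Proof. by rewrite !form1E; apply: eq_bigr => i _; rewrite mulrC. Qed.

(** The squared norm of [a x - b y] is nonnegative. *)
Lemma form1_young k (a b : R) (x y : 'cV[R]_k) :
  2 * (a * b) * form 1%:M x y <= a ^+ 2 * sqn x + b ^+ 2 * sqn y.
Proof.
have := sqn_ge0 (a *: x + (- b) *: y).
rewrite -form1_sqn !(formDl, formDr, formZl, formZr) !form1_sqn (form1C y x).
by move=> h; lra.
Qed.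

Lemma form_le_sqn k (P : 'M[R]_k) :
  exists2 c : R, 0 <= c & forall x : 'cV[R]_k, form P x x <= c * sqn x.
Proof.
have [c c0 cP] := sqn_mulmx_le P; exists (1 + c); first by rewrite addr_ge0.
move=> x; have -> : form P x x = form 1%:M x (P *m x) by rewrite /form mulmx1 mulmxA.
have := form1_young 1 1 x (P *m x); have := cP x; have := sqn_ge0 x.
have := sqn_ge0 (P *m x).
rewrite expr1n !mul1r mulr1 mulrDl mul1r; set u := form _ _ _; set v := sqn _.
nra.
Qed.

Lemma sqn_col_mx k l (x : 'cV[R]_k) (y : 'cV[R]_l) :
  sqn (col_mx x y) = sqn x + sqn y.
Proof.
rewrite /sqn big_split_ord/=; congr (_ + _); apply: eq_bigr => i _.
- by rewrite col_mxEu.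
- by rewrite col_mxEd.
Qed.

Lemma formE N (P : 'M[R]_N) (x y : 'cV[R]_N) :
  form P x y = \sum_i x i 0 * (P *m y) i 0.
Proof. by rewrite /form -mulmxA mxE; apply: eq_bigr => i _; rewrite mxE. Qed.

Lemma form_fctE N (P : 'M[R]_N) (T : Type) (x y : T -> 'cV[R]_N) :
  (fun t => form P (x t) (y t))
  = \sum_i ((fun t => x t i 0) * (fun t => (P *m y t) i 0)).
Proof.
apply/funext => t; rewrite formE fct_sumE; exact: eq_bigr.
Qed.

Lemma cvg_form N (P : 'M[R]_N) (T : Type) (F : set_system T) {FF : Filter F}
    (x y : T -> 'cV[R]_N) a b :
  x t @[t --> F] --> a -> y t @[t --> F] --> b ->
  form P (x t) (y t) @[t --> F] --> form P a b.
Proof.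
move=> xa yb; rewrite form_fctE formE.
have /cvg_mxP Pyb : P *m y t @[t --> F] --> P *m b by exact: cvg_mulmx.
elim/big_ind2: _ => [|g c h d gc hd|i _]; first exact: cvg_cst.
- exact: cvgD.
- by apply: cvgM; [exact: ((cvg_mxP _ _).1 xa)|exact: Pyb].
Qed.

Lemma is_derive_form N (P : 'M[R]_N) (x y : R -> 'cV[R]_N) dx dy (t : R) :
  is_derive t 1 x dx -> is_derive t 1 y dy ->
  is_derive t 1 (fun s => form P (x s) (y s)) (form P (x t) dy + form P dx (y t)).
Proof.
move=> xD yD; rewrite form_fctE.
have /is_derive_mxP PyD := is_derive_mulmx P yD.
move/is_derive_mxP : xD => xD.
rewrite !formE -big_split/=.
apply: is_derive_sum => i.
have := is_deriveM (xD i 0) (PyD i 0).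
by move=> h; apply: (is_derive_eq h); rewrite /GRing.scale/= (mulrC _ (dx i 0)).
Qed.

End quadratic_forms.

(** * Quadratic Lyapunov forms from the spectrum *)

Section lyapunov.
Context {R : realType}.

(** The real polynomial [(X - a)^2 + b^2], with roots [a + ib] and [a - ib],
    evaluated at [A]. *)
Definition quad_mx (N : nat) (A : 'M[R]_N) (a b : R) : 'M[R]_N :=
  (A - a%:M) *m (A - a%:M) + (b ^+ 2)%:M.

(** Restricting the inequalities to the vectors satisfying [X] makes room for
    an induction on the factors of a polynomial annihilating these vectors. *)
Definition lyapunov_on (N : nat) (A : 'M[R]_N) (X : 'cV[R]_N -> Prop) : Prop :=
  exists P : 'M[R]_N, exists eps mu : R, [/\ 0 < eps, 0 < mu &
    forall x, X x -> eps * sqn x <= form P x x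
      /\ form P x (A *m x) + form P (A *m x) x <= - mu * form P x x].

Lemma quad_mxC N (A : 'M[R]_N) a b : quad_mx A a b *m A = A *m quad_mx A a b.
Proof.
have shiftC : (A - a%:M) *m A = A *m (A - a%:M).
  by rewrite mulmxBl mulmxBr scalar_mxC.
by rewrite /quad_mx mulmxDl mulmxDr -mulmxA shiftC !mulmxA shiftC scalar_mxC.
Qed.

(** Put [v = (A - a) x] and let [y] be the image of [x] by the quadratic. Then
    [A x = a x + v] and [A v = a v - b^2 x + y]: along the flow of [A], the pair
    [(x, v)] is a damped oscillator driven by [y]. The energy
    [|v|^2 + b^2 |x|^2] has derivative [2a] times itself, plus [2 <v, y>]. Adding
    [d^2 |x|^2] keeps the energy definite when [b = 0], and with [d = - a / 2]
    the cross terms cost at most half of the damping. The remaining [|y|^2] is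
    absorbed by a large multiple of the form already known to decay on [y]. *)
Lemma lyapunov_step N (A : 'M[R]_N) (a b : R) (X : 'cV[R]_N -> Prop) :
  a < 0 -> lyapunov_on A X -> lyapunov_on A (fun x => X (quad_mx A a b *m x)).
Proof.
move=> a0 [P [eps [mu [eps0 mu0 PX]]]].
have [d d0 ad] : exists2 d, 0 < d & a = - 2 * d by exists (- a / 2); lra.
(* with this weight, half the decay of the form on y pays for |y|^2 / d *)
pose c := 2 / (mu * d * eps).
have c0 : 0 < c by rewrite divr_gt0// !mulr_gt0.
pose Q := quad_mx A a b; pose A' := A - a%:M.
exists (A'^T *m 1%:M *m A' + (b ^+ 2 + d ^+ 2) *: 1%:M + c *: (Q^T *m P *m Q)).
exists (d ^+ 2), (Num.min (2 * d) (mu / 2)).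
split; [by rewrite exprn_gt0|by rewrite lt_min mulr_gt0// divr_gt0|].
move=> x /PX; rewrite -/Q; set y := Q *m x => -[Py dPy].
rewrite !(form_mxD, form_mxZ, form_mulmx).
pose v := A' *m x.
have Ax : A *m x = a *: x + v by rewrite /v mulmxBl mul_scalar_mx addrC subrK.
have QAx : Q *m (A *m x) = A *m y by rewrite mulmxA quad_mxC -mulmxA.
have A'v : A' *m (A *m x) = a *: v + y - (b ^+ 2) *: x.
  rewrite Ax mulmxDr -scalemxAr -/v -addrA; congr (_ + _).
  by rewrite /y /Q /quad_mx mulmxDl mul_scalar_mx addrK -mulmxA.
rewrite QAx A'v -/y -/v Ax.
rewrite -scaleNr !(formDl, formDr, formZl, formZr) !form1_sqn.
rewrite (form1C y v) (form1C v x).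
have xv := form1_young d 1 x v; have vy := form1_young d 1 v y.
move: xv vy Py dPy; rewrite !mulr1 !expr1n !mul1r.
have : 0 <= sqn x := sqn_ge0 x; have : 0 <= sqn v := sqn_ge0 v.
have : 0 <= sqn y := sqn_ge0 y.
set fxv := form _ x v; set fvy := form _ v y; set Vn := form P y y.
move: (form P y (A *m y)) (form P (A *m y) y) => D1 D2.
move: (sqn x) (sqn v) (sqn y) => X2 V2 Y2 Y0 V0 X0 xv vy Py dPy.
have Vn0 : 0 <= Vn by apply: le_trans Py; rewrite mulr_ge0// ltW.
have b20 : 0 <= b ^+ 2 := sqr_ge0 b.
have cVn : 0 <= c * Vn by rewrite mulr_ge0// ltW.
pose E := V2 + (b ^+ 2 + d ^+ 2) * X2.
have E0 : 0 <= E by rewrite addr_ge0// mulr_ge0// addr_ge0// ?sqr_ge0.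
split.
  by rewrite -/Vn; have := mulr_ge0 b20 X0; nra.
(* the drive 2 <v, y>, split by the Young inequality with weight d *)
have vy' : 2 * fvy <= d * V2 + (mu / 2) * (c * Vn).
  have -> : (mu / 2) * (c * Vn) = d^-1 * (eps^-1 * Vn).
    by rewrite /c; field; rewrite !gt_eqF.
  have Yle : Y2 <= eps^-1 * Vn by rewrite ler_pdivlMl.
  have -> : 2 * fvy = d^-1 * (2 * d * fvy) by field; rewrite gt_eqF.
  apply: (@le_trans _ _ (d^-1 * (d ^+ 2 * V2 + Y2))).
    by rewrite ler_pM2l ?invr_gt0.
  rewrite mulrDr lerD//; first by rewrite expr2 mulrA mulKf// gt_eqF.
  by rewrite ler_pM2l ?invr_gt0.
have xv' : 2 * d ^+ 2 * fxv <= d * E.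
  apply: (@le_trans _ _ (d * (d ^+ 2 * X2 + V2))).
    by rewrite (_ : 2 * d ^+ 2 * fxv = d * (2 * d * fxv)) ?ler_pM2l//; ring.
  by rewrite ler_pM2l// /E; have := mulr_ge0 b20 X0; lra.
have dV : c * (D1 + D2) <= - mu * (c * Vn).
  by rewrite (mulrCA (- mu)) ler_pM2l.
set rho := Num.min _ _.
have r1 : rho * E <= 2 * d * E by rewrite ler_wpM2r// /rho ge_min lexx.
have r2 : rho * (c * Vn) <= (mu / 2) * (c * Vn).
  by rewrite ler_wpM2r// /rho ge_min lexx orbT.
have dE : d * V2 <= d * E.
  by rewrite ler_pM2l// /E lerDl mulr_ge0// addr_ge0// sqr_ge0.
rewrite -/E mulrDr.
subst a; rewrite /E in r1 r2 dE xv' *.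
lra.
Qed.

End lyapunov.

Section spectrum.
Context {R : realType}.
Local Notation toC := (real_complex R).

(** The real quadratic polynomial with roots [z] and its conjugate. *)
Definition quad_poly (z : R[i]) : {poly R} :=
  ('X - (complex.Re z)%:P) ^+ 2 + (complex.Im z ^+ 2)%:P.

Lemma map_quad_poly (z : R[i]) :
  map_poly toC (quad_poly z) = ('X - z%:P) * ('X - (conjc z)%:P).
Proof.
rewrite rmorphD rmorphXn rmorphB/= map_polyX !map_polyC/=.
case: z => a b /=.
have -> : (a +i* b)%C = toC a + 'i%C * toC b.
  by apply/eqP; rewrite eq_complex /=; apply/andP; split; apply/eqP; ring.
have -> : (a -i* b)%C = toC a - 'i%C * toC b.
  by apply/eqP; rewrite eq_complex /=; apply/andP; split; apply/eqP; ring.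
have i2 : ('i%C : R[i]) ^+ 2 = - 1 by exact: sqr_i.
rewrite !(rmorphB, rmorphD, rmorphM, rmorphXn)/=.
set x := (toC a)%:P; set y := (toC b)%:P; set j := ('i%C)%:P.
have j2 : j ^+ 2 = -1 by rewrite /j -rmorphXn/= i2 rmorphN rmorph1.
have -> : y * y = - (j ^+ 2 * (y * y)) by rewrite j2 mulN1r opprK.
ring.
Qed.

(** A real polynomial is also the product of the conjugate linear factors, so
    its square pairs each root with the conjugate root. *)
Lemma real_poly_quad_factor (p : {poly R}) (zs : seq R[i]) :
  map_poly toC p = \prod_(z <- zs) ('X - z%:P) ->
  p ^+ 2 = \prod_(z <- zs) quad_poly z.
Proof.
move=> pE; apply: (map_poly_inj toC).
(* p is fixed by conjugation of the coefficients *)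
have cpE : map_poly toC p = \prod_(z <- zs) ('X - (conjc z)%:P).
  have -> : map_poly toC p = map_poly conjc (map_poly toC p).
    rewrite -map_poly_comp; apply: eq_map_poly => x /=.
    by rewrite /real_complex_def oppr0.
  rewrite pE rmorph_prod; apply: eq_bigr => z _.
  by rewrite rmorphB/= map_polyX map_polyC.
rewrite rmorphXn/= expr2 {1}pE cpE -big_split rmorph_prod/=.
by apply: eq_bigr => z _; rewrite map_quad_poly.
Qed.

Lemma foldl_quad_mx (n : nat) (A : 'M[R]_n.+1) (zs : seq R[i]) (x : 'cV[R]_n.+1) :
  foldl (fun y z => quad_mx A (complex.Re z) (complex.Im z) *m y) x zs
  = horner_mx A (\prod_(z <- zs) quad_poly z) *m x.
Proof.
elim: zs x => [|z zs IH] x /=; first by rewrite big_nil rmorph1 mul1mx.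
rewrite IH big_cons mulrC rmorphM/= -mulmxE -mulmxA; congr (_ *m (_ *m _)).
rewrite /quad_poly rmorphD rmorphXn rmorphB/= horner_mx_X !horner_mx_C.
by rewrite expr2.
Qed.

(** Composing the quadratics by [foldl] applies them to the vector one after
    the other, in the form that [lyapunov_step] peels off. *)
Lemma lyapunov_foldl (N : nat) (A : 'M[R]_N) (zs : seq R[i]) :
  (forall z, z \in zs -> complex.Re z < 0) ->
  lyapunov_on A (fun x =>
    foldl (fun y z => quad_mx A (complex.Re z) (complex.Im z) *m y) x zs = 0).
Proof.
elim: zs => [_|z zs IH zs0] /=.
  exists 0, 1, 1; split => // x ->.
  by rewrite /form !mulmx0 mxE mulr0 addr0 -form1_sqn /form mulmx0 mxE mulr0.
have zs0' : forall w, w \in zs -> complex.Re w < 0.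
  by move=> w wzs; apply: zs0; rewrite in_cons wzs orbT.
exact: lyapunov_step (zs0 z (mem_head _ _)) (IH zs0').
Qed.

(** The square of the characteristic polynomial is the product of the
    quadratics attached to the eigenvalues, so by Cayley-Hamilton these
    quadratics, applied in succession, annihilate every vector. *)
Theorem lyapunov_of_eigenvalues (N : nat) (A : 'M[R]_N) :
  (forall z, eigenvalue (map_mx toC A) z -> complex.Re z < 0) ->
  lyapunov_on A (fun=> True).
Proof.
case: N A => [A _|n A eA].
  have [P [eps [mu [e0 m0 h]]]] := 
    @lyapunov_foldl _ A [::] (fun z zs0 => False_ind _ (notF zs0)).
  by exists P, eps, mu; split=> // x _; apply: h; rewrite /= flatmx0.
have [zs zsE] := closed_field_poly_normal (char_poly (map_mx toC A)).
move: zsE; rewrite (monicP (char_poly_monic _)) scale1r => zsE.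
have zsP z : z \in zs -> complex.Re z < 0.
  by move=> zzs; apply: eA; rewrite eigenvalue_root_char zsE root_prod_XsubC.
have [P [eps [mu [e0 m0 h]]]] := lyapunov_foldl A zsP.
exists P, eps, mu; split=> // x _; apply: h; rewrite foldl_quad_mx.
rewrite -(@real_poly_quad_factor (char_poly A)); last by rewrite map_char_poly.
by rewrite rmorphXn/= Cayley_Hamilton expr0n mul0mx.
Qed.

(** The supremum is meaningful because the spectrum is a finite set of
    roots. *)
Lemma spectral_abscissa_ge (N : nat) (A : 'M[R]_N) (z : R[i]) :
  eigenvalue (map_mx toC A) z -> complex.Re z <= spectral_abscissa A.
Proof.
move=> zA; apply: ub_le_sup; last by exists z.
have [zs zsE] := closed_field_poly_normal (char_poly (map_mx toC A)).
move: zsE; rewrite (monicP (char_poly_monic _)) scale1r => zsE.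
exists (\sum_(w <- zs) `|complex.Re w|) => _ [w wA <-].
have : w \in zs.
  by rewrite -root_prod_XsubC -zsE -eigenvalue_root_char.
move=> wzs; rewrite (big_rem w)//=; apply: le_trans (ler_norm _) _.
by rewrite lerDl sumr_ge0.
Qed.

End spectrum.

(** * Linear systems: existence and exponential stability *)

(** Right-continuity at 0 is what lets estimates that come from the equation,
    imposed for [0 < t] only, start from the value [x 0]. *)
Definition solves_at_pos {R : realType} {N : nat} (A : 'M[R]_N)
    (x : R -> 'cV[R]_N) : Prop :=
  x t @[t --> 0^'+] --> x 0 /\ forall t : R, 0 < t -> is_derive t 1 x (A *m x t).

Section linear_flow.
Context {R : realType}.

(** Comparison with the exponential series at [a |x|]. *)
Lemma cvg_pseries_exp_bound (c : R ^nat) (a b : R) :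
  0 <= a -> (forall k, `|c k| <= b * a ^+ k / k`!%:R) ->
  forall x : R, cvgn (pseries c x).
Proof.
move=> a0 cb x; apply: normed_cvg.
apply: (@series_le_cvg _ _ (fun k => b * exp_coeff (a * `|x|) k)) => [k|k|k|].
- exact: normr_ge0.
- apply: le_trans (normr_ge0 (c k * x ^+ k)) _.
  rewrite normrM normrX /exp_coeff/= exprMn.
  rewrite (_ : b * _ = b * a ^+ k / k`!%:R * `|x| ^+ k); last by ring.
  by rewrite ler_wpM2r// exprn_ge0.
- rewrite /= normrM normrX /exp_coeff/= exprMn.
  rewrite (_ : b * _ = b * a ^+ k / k`!%:R * `|x| ^+ k); last by ring.
  by rewrite ler_wpM2r// exprn_ge0.
- rewrite (_ : series _ = b \*: series (exp_coeff (a * `|x|))); last first.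
    by apply/funext => n; rewrite /series/= scaler_sumr.
  by apply: is_cvgZr; exact: is_cvg_series_exp_coeff.
Qed.

(** Bounds of exponential type survive termwise differentiation, so the
    derived series of every order converge as well. *)
Lemma pseries_diffs_exp_bound (c : R ^nat) (a b : R) :
  (forall k, `|c k| <= b * a ^+ k / k`!%:R) ->
  forall k, `|pseries_diffs c k| <= b * a * a ^+ k / k`!%:R.
Proof.
move=> cb k; rewrite /pseries_diffs normrM normr_nat.
apply: le_trans (ler_wpM2l (ler0n _ _) (cb k.+1)) _.
rewrite factS natrM exprS le_eqVlt; apply/orP; left; apply/eqP.
by field; rewrite nat1r !pnatr_eq0 -lt0n fact_gt0.
Qed.

Lemma norm_iter_mulmx_le N (A : 'M[R]_N) (x0 : 'cV[R]_N) k i :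
  `|iter k (mulmx A) x0 i 0| <= (\sum_j `|x0 j 0|) * (\sum_i \sum_j `|A i j|) ^+ k.
Proof.
elim: k i => [|k IH] i.
  by rewrite /= expr0 mulr1 (bigD1 i)//= lerDl sumr_ge0.
rewrite iterS mxE; apply: le_trans (ler_norm_sum _ _ _) _.
set b : R := \sum_j `|x0 j 0|; set a : R := \sum_i0 \sum_j `|A i0 j|.
apply: (@le_trans _ _ (\sum_j `|A i j| * (b * a ^+ k))).
  by apply: ler_sum => j _; rewrite normrM ler_wpM2l.
rewrite -mulr_suml exprS [leRHS]mulrCA ler_wpM2r//.
  rewrite mulr_ge0 ?exprn_ge0 ?sumr_ge0// => l _; exact: sumr_ge0.
rewrite /a [leRHS](bigD1 i)//= lerDl sumr_ge0// => l _; exact: sumr_ge0.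
Qed.

(** Each coordinate is a power series with coefficients [(A^k x0)_i / k!],
    whose termwise derivative is the corresponding combination of the
    coordinate series. *)
Theorem linear_flow_exists N (A : 'M[R]_N) (x0 : 'cV[R]_N) :
  exists x : R -> 'cV[R]_N,
    x 0 = x0 /\ forall t : R, is_derive t 1 x (A *m x t).
Proof.
pose c (i : 'I_N) (k : nat) : R := iter k (mulmx A) x0 i 0 / k`!%:R.
have cb i k : `|c i k| <= (\sum_j `|x0 j 0|) * (\sum_i \sum_j `|A i j|) ^+ k / k`!%:R.
  rewrite /c normrM normfV normr_nat ler_wpM2r ?invr_ge0//.
  exact: norm_iter_mulmx_le.
have a0 : 0 <= \sum_i \sum_j `|A i j|.
  by apply: sumr_ge0 => i _; exact: sumr_ge0.
have cc i t : cvgn (pseries (c i) t) by exact: cvg_pseries_exp_bound (cb i) t.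
exists (fun t => \col_i limn (pseries (c i) t)); split.
  apply/matrixP => i j; rewrite ord1 mxE.
  apply/cvg_lim => //.
  rewrite -cvg_shiftS /=.
  rewrite (_ : (fun n => _) = cst (x0 i 0)); first exact: cvg_cst.
  apply/funext => n; rewrite /pseries /series/= big_nat_recl//= big1 ?addr0.
    by rewrite /c /= fact0 divr1 expr0 mulr1.
  by move=> k _; rewrite expr0n mulr0.
move=> t; apply/is_derive_mxP => i j; rewrite ord1.
rewrite (_ : (fun u => _) = (fun u => limn (pseries (c i) u))); last first.
  by apply/funext => u; rewrite mxE.
have -> : (A *m (\col_i limn (pseries (c i) t))) i 0
    = limn (pseries (pseries_diffs (c i)) t).
  apply/esym/cvg_lim => //.
  have -> : pseries (pseries_diffs (c i)) t
      = fun n => (A *m (\col_j pseries (c j) t n)) i 0.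
    apply/funext => n; rewrite mxE /pseries /series/=.
    under [RHS]eq_bigr do rewrite mxE mulr_sumr.
    rewrite exchange_big/=; apply: eq_bigr => k _.
    rewrite /pseries_diffs /c iterS mxE factS natrM mulr_suml mulr_sumr mulr_suml.
    apply: eq_bigr => l _.
    by field; rewrite nat1r !pnatr_eq0 -lt0n fact_gt0.
  move: i {j}; have /cvg_mxP h :
      A *m (\col_j pseries (c j) t n) @[n --> \oo] --> A *m (\col_j limn (pseries (c j) t)).
    apply: cvg_mulmx; apply/cvg_mxP => i j; rewrite mxE.
    under eq_fun do rewrite mxE.
    exact: cc.
  by move=> i; exact: h.
apply: (@pseries_snd_diffs _ _ (`|t| + 1)).
- exact: cc.
- exact: cvg_pseries_exp_bound a0 (pseries_diffs_exp_bound (cb i)) _.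
- exact: cvg_pseries_exp_bound a0
    (pseries_diffs_exp_bound (pseries_diffs_exp_bound (cb i))) _.
- by rewrite [ltRHS]ger0_norm ?ltrDl ?addr_ge0.
Qed.

End linear_flow.

Section stability.
Context {R : realType}.

(** A Lyapunov form decays exponentially along solutions and is equivalent to
    the squared norm. *)
Theorem stable_decay N (A : 'M[R]_N) :
  spectral_abscissa A < 0 ->
  exists c mu : R, [/\ 0 <= c, 0 < mu & forall z, solves_at_pos A z ->
    forall t : R, 0 <= t -> sqn (z t) <= c * expR (- mu * t) * sqn (z 0)].
Proof.
move=> sA.
have [z zA|P [eps [mu [eps0 mu0 PA]]]] := @lyapunov_of_eigenvalues _ _ A.
  exact: le_lt_trans (spectral_abscissa_ge zA) sA.
have [c c0 cP] := form_le_sqn P.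
exists (eps^-1 * c), mu; split=> //; first by rewrite mulr_ge0// invr_ge0 ltW.
move=> z [z0 zD] t t0.
have V : form P (z t) (z t) <= expR (- mu * t) * form P (z 0) (z 0).
  apply: (decay_of_diff_ineq (V := fun t => form P (z t) (z t))
    (dV := fun t => form P (z t) (A *m z t) + form P (A *m z t) (z t)))
    => // [|s s0|s s0].
  - exact: cvg_form.
  - exact: is_derive_form (zD s s0) (zD s s0).
  - exact: (PA _ I).2.
rewrite -!mulrA ler_pdivlMl//; apply: le_trans (PA _ I).1 _.
apply: le_trans V _; rewrite [leRHS]mulrCA ler_wpM2l// ?expR_ge0//.
Qed.

Lemma cvg_sqn0 (T : Type) (F : set_system T) {FF : Filter F} N
    (x : T -> 'cV[R]_N) :
  sqn (x t) @[t --> F] --> (0 : R) -> x t @[t --> F] --> (0 : 'cV[R]_N).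
Proof.
move=> x0; apply/cvg_mxP => i j; rewrite ord1 mxE.
apply/cvgr0Pnorm_le => e e0.
move/cvgr0Pnorm_le : x0 => /(_ (e ^+ 2) (exprn_gt0 _ e0)).
apply: filterS => t; rewrite ger0_norm ?sqn_ge0// => /(le_trans (sqr_le_sqn _ i)).
by rewrite -[leLHS]real_normK ?num_real// ler_sqr ?nnegrE// ltW.
Qed.

Lemma cvg_expR_Nscale (mu : R) : 0 < mu ->
  expR (- mu * t) @[t --> +oo] --> (0 : R).
Proof.
move=> mu0; under eq_fun do rewrite mulNr.
apply: (@cvg_comp _ _ _ (fun t : R => mu * t) (fun t => expR (- t)) _ +oo);
  last exact: cvgr_expR.
exact: gt0_cvgMry.
Qed.

Lemma cvg_sqn_expR k (x : R -> 'cV[R]_k) (c mu : R) :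
  0 < mu -> (forall t : R, 0 <= t -> sqn (x t) <= c * expR (- mu * t)) ->
  x t @[t --> +oo] --> (0 : 'cV[R]_k).
Proof.
move=> mu0 xle; apply: cvg_sqn0.
apply: (@squeeze_cvgr _ _ _ _ (cst 0) (fun t => c * expR (- mu * t))).
- near=> t; rewrite sqn_ge0/= xle//; near: t; exact: nbhs_pinfty_ge.
- exact: cvg_cst.
- by rewrite -(mulr0 c); apply: cvgM; [exact: cvg_cst|exact: cvg_expR_Nscale].
Unshelve. all: by end_near. Qed.

End stability.

(** * Cycle space, cut space and tuned gains *)

Lemma mem_im_mx {R : realType} k l (A : 'M[R]_(k, l)) (x : 'cV[R]_k) :
  x \in im_mx A <-> exists y, x = A *m y.
Proof.
split=> [/memv_imgP[y _ ->]|[y ->]]; first by exists y; rewrite lfunE.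
by apply/memv_imgP; exists y; rewrite ?memvf// lfunE.
Qed.

Lemma mem_ker_mx {R : realType} k l (A : 'M[R]_(k, l)) (x : 'cV[R]_l) :
  (x \in ker_mx A) = (A *m x == 0).
Proof. by rewrite memv_ker lfunE. Qed.

Lemma mulmx_col {R : realType} k l p (A : 'M[R]_(k, l)) (X : 'M[R]_(l, p)) j :
  A *m col j X = col j (A *m X).
Proof. by rewrite !colE mulmxA. Qed.

Lemma pos_diag_unit {R : realType} k (A : 'M[R]_k) : pos_diag A -> A \in unitmx.
Proof.
move=> [/is_diag_mxP Ad A0].
have -> : A = diag_mx (\row_i A i i).
  apply/matrixP => i j; rewrite !mxE; have [->|ij] := eqVneq i j; first by rewrite mulr1n.
  by rewrite mulr0n Ad.
rewrite unitmxE det_diag unitfE; apply/prodf_neq0 => e _.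
by rewrite mxE gt_eqF.
Qed.

Section network.
Context {R : realType} {n m : nat} (net : network R n m).
Local Notation B := (incidence net).
Local Notation W := (Wop net).
Implicit Types (H : 'M[R]_(m, b1 n m)).

Lemma Wop_unit : network_ok net -> W \in unitmx.
Proof.
move=> [_ _ _ a0 [g [g0 gpi cohe]]].
rewrite unitmxE det_diag unitfE; apply/prodf_neq0 => e _; rewrite mxE.
rewrite gt_eqF// mulr_gt0// cos_gt0_pihalf//.
by rewrite -ltr_norml (le_lt_trans (cohe e)).
Qed.

Lemma incidence_mul_basis H : harmonic_basis net H -> B *m H = 0.
Proof.
move=> [Hb _]; apply/row_matrixP => i; apply/rowP => j; rewrite row0.
suff /matrixP /(_ i 0) : B *m col j H = 0.
  by rewrite mulmx_col !mxE.
apply/eqP; rewrite -mem_ker_mx; apply: (basis_mem Hb).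
by apply: map_f; rewrite mem_enum.
Qed.

Lemma kernel_sub_basis H p (X : 'M[R]_(m, p)) :
  harmonic_basis net H -> B *m X = 0 -> exists Y, X = H *m Y.
Proof.
move=> [Hb _] BX.
have colX j : exists y : 'cV[R]_(b1 n m), col j X = H *m y.
  have : col j X \in ker_mx B.
    by rewrite mem_ker_mx mulmx_col BX; apply/eqP/matrixP => i k; rewrite !mxE.
  rewrite -(span_basis Hb) => /(coord_span (X := [tuple col i H | i < b1 n m])) ->.
  exists (\col_i coord [tuple col i H | i < b1 n m] i (col j X)).
  apply/matrixP => i k; rewrite summxE mxE; apply: eq_bigr => l _.
  by rewrite -tnth_nth tnth_mktuple !mxE mulrC.
exists (\matrix_(i, j) (sval (cid (colX j)) i 0)).
apply/matrixP => i j.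
have := svalP (cid (colX j)) => /matrixP/(_ i 0); rewrite !mxE => ->.
by apply: eq_bigr => k _; rewrite mxE.
Qed.

Lemma basis_orth_cut H : W \in unitmx -> harmonic_basis net H ->
  H^T *m invmx W *m (W *m B^T) = 0.
Proof.
move=> Wu Hb; rewrite -mulmxA (mulmxA (invmx W)) mulVmx// mul1mx.
by rewrite -trmx_mul (incidence_mul_basis Hb) trmx0.
Qed.

(** The columns of [cokermx B] lie in [ker B], so they are combinations of
    the columns of [H] and are orthogonal to [v]; this is the criterion for
    [v^T] to lie in the row space of [B]. *)
Lemma row_space_of_kernel_orth H (v : 'cV[R]_m) :
  harmonic_basis net H -> H^T *m v = 0 -> exists d, v = B^T *m d.
Proof.
move=> Hb Hv.
have [Y kE] := kernel_sub_basis Hb (mulmx_coker B).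
have : (v^T <= B)%MS.
  by rewrite submxE kE mulmxA -[v^T *m H]trmxK trmx_mul trmxK Hv trmx0 mul0mx.
by move=> /submxP[d vE]; exists d^T; rewrite -trmx_mul -vE trmxK.
Qed.

(** The vector [W^-1 P_C r] is orthogonal to [ker B], by the normalization of
    [H]. *)
Lemma P_C_cut H (r : 'cV[R]_m) : W \in unitmx -> harmonic_basis net H ->
  P_C net H *m r \in cut_space net.
Proof.
move=> Wu Hb.
have : H^T *m (invmx W *m (P_C net H *m r)) = 0.
  rewrite /P_C /P_H !mulmxA mulmxBr mulmx1 !mulmxA Hb.2 mul1mx subrr mul0mx//.
move=> /(row_space_of_kernel_orth Hb)[d dE].
apply/mem_im_mx; exists d; rewrite -mulmxA -dE mulmxA mulmxV// mul1mx//.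
Qed.

Lemma P_C_id H (r : 'cV[R]_m) : W \in unitmx -> harmonic_basis net H ->
  r \in cut_space net -> P_C net H *m r = r.
Proof.
move=> Wu Hb /mem_im_mx[y ->].
rewrite /P_C /P_H mulmxBl mul1mx mulmxA -(mulmxA H) -(mulmxA H).
by rewrite basis_orth_cut// mulmx0 mul0mx subr0.
Qed.

Section channels.
Context {ns na : nat} (S : 'M[R]_(ns, m)) (C : 'M[R]_(m, na)) (K : 'M[R]_(na, ns)).

Lemma cut_forcingE H (r : 'cV[R]_m) : W \in unitmx -> harmonic_basis net H ->
  cut_forcing net H S C K r = L_H net H S C K *m (P_C net H *m r).
Proof.
by move=> Wu Hb; rewrite /cut_forcing lfunE/= vsprojK// P_C_cut.
Qed.

(** [P_C] is a projection with image the cut space. *)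
Lemma L_HC_eq0 H : W \in unitmx -> harmonic_basis net H ->
  L_HC net H S C K = 0 <-> L_H net H S C K *m P_C net H = 0.
Proof.
move=> Wu Hb; split=> [L0|L0].
- apply/matrixP => i j.
  have := cut_forcingE (delta_mx j 0) Wu Hb.
  rewrite /cut_forcing L0 lfunE/= mulmxA -colE => /matrixP/(_ i 0).
  by rewrite !mxE => <-.
- apply/lfunP => x; rewrite zero_lfunE lfunE/=.
  by rewrite -(P_C_id Wu Hb (subvsP x)) mulmxA L0 mul0mx.
Qed.

(** The component of [r] in [ker B] is [H h], on which the tuned gain acts as
    [- kappa]; the other component lies in the cut space. *)
Lemma harmonic_split H (kappa : R) (r : 'cV[R]_m) :
  W \in unitmx -> harmonic_basis net H -> tuned_gain net H S C kappa K ->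
  L_H net H S C K *m r
  = - kappa *: harmonic_coord net H r + cut_forcing net H S C K r.
Proof.
move=> Wu Hb tg; rewrite cut_forcingE// /P_C mulmxBl mul1mx mulmxBr.
suff -> : L_H net H S C K *m (P_H net H *m r) = - kappa *: harmonic_coord net H r.
  by rewrite addrC subrK.
rewrite /P_H /harmonic_coord !mulmxA.
have -> : L_H net H S C K *m H = - kappa *: 1%:M by [].
by rewrite -!scalemxAl mul1mx.
Qed.

(** The phases contribute only cut vectors, which the harmonic coordinate
    does not see. *)
Lemma harmonic_coord_flow H (th : 'cV[R]_n) (w : 'cV[R]_m) :
  W \in unitmx -> harmonic_basis net H ->
  harmonic_coord net H (flow net th w) = H^T *m w.
Proof.
move=> Wu Hb; rewrite /harmonic_coord /flow mulmxDr.
rewrite !mulmxA -(mulmxA _ W) basis_orth_cut// mul0mx add0r.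
by rewrite -(mulmxA _ (invmx W)) mulVmx// mulmx1.
Qed.

Lemma tuned_gain_exists H (kappa : R) :
  \rank (S *m H) = b1 n m -> \rank (H^T *m invmx W *m C) = b1 n m ->
  exists K, tuned_gain net H S C kappa K.
Proof.
move=> rS rC.
have G2E : H^T *m invmx W *m C *m pinvmx (H^T *m invmx W *m C) = 1%:M.
  by apply: mulmxVp; rewrite /row_free rC.
have : pinvmx (S *m H) *m (S *m H) = 1%:M by apply: mulVpmx; rewrite /row_full rS.
move: (pinvmx (S *m H)) => G1 G1E.
move: (pinvmx _) G2E => G2 G2E.
exists (- kappa *: (G2 *m G1)).
rewrite /tuned_gain /L_HH -scalemxAr -!scalemxAl.
by congr (_ *: _); rewrite !mulmxA G2E mul1mx -mulmxA.
Qed.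

End channels.

Lemma tuned_gain_square H (S : 'M[R]_(b1 n m, m)) (C : 'M[R]_(m, b1 n m))
    (kappa : R) (K : 'M[R]_(b1 n m)) :
  \rank (S *m H) = b1 n m -> \rank (H^T *m invmx W *m C) = b1 n m ->
  tuned_gain net H S C kappa K <->
  K = - kappa *: (invmx (H^T *m invmx W *m C) *m invmx (S *m H)).
Proof.
move=> rS rC.
have : S *m H \in unitmx by rewrite -row_free_unit /row_free rS.
have : H^T *m invmx W *m C \in unitmx by rewrite -row_free_unit /row_free rC.
have -> : tuned_gain net H S C kappa K
    = (H^T *m invmx W *m C *m K *m (S *m H) = - kappa *: 1%:M).
  by rewrite mulmxA.
move: (H^T *m invmx W *m C) (S *m H) => X Y Xu Yu.
split=> [XKY|->]; last first.
  by rewrite -scalemxAr -scalemxAl !mulmxA mulmxV// mul1mx mulVmx.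
rewrite -[K](mulKmx Xu) -[X *m K](mulmxK Yu) XKY.
by rewrite -scalemxAl mul1mx -scalemxAr.
Qed.

End network.

(** * The harmonic coordinate along tangent solutions *)

Section dynamics.
Context {R : realType} {n m : nat} (net : network R n m).
Local Notation B := (incidence net).
Local Notation W := (Wop net).
Implicit Types (H : 'M[R]_(m, b1 n m)).

Section channels.
Context {ns na : nat} (S : 'M[R]_(ns, m)) (C : 'M[R]_(m, na)) (K : 'M[R]_(na, ns)).

(** The layout of states that [tangent_mx] expects. *)
Definition stacked (th nu : 'cV[R]_n) (w : 'cV[R]_m) : 'cV[R]_(n + (n + m)) :=
  col_mx th (col_mx nu w).

Lemma tangent_mx_stacked tau th nu w :
  tangent_mx net tau S C K *m stacked th nu w
  = stacked nu
      (- (invmx (mass net) *m (damping net *m nu + B *m flow net th w)))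
      (tau^-1 *: (invmx W *m C *m K *m S *m flow net th w)).
Proof.
rewrite /tangent_mx /stacked !mul_col_mx !mul_row_col !mul0mx !mul1mx !add0r !addr0.
congr (col_mx _ (col_mx _ _)).
- rewrite /flow !mulmxDr !mulmxA !mulNmx !opprD -!mulmxA.
  by rewrite addrCA.
- rewrite /flow -!scalemxAl -scalerDr; congr (_ *: _).
  by rewrite mulmxDr !mulmxA.
Qed.

Lemma tangent_solution_stacked tau th nu w :
  network_ok net -> 0 < tau -> tangent_solution net tau S C K th nu w ->
  solves_at_pos (tangent_mx net tau S C K) (fun t => stacked (th t) (nu t) (w t)).
Proof.
move=> ok tau0 [thD nuD wD sol].
have Mu : mass net \in unitmx by apply: pos_diag_unit; case: ok => _ _ [].
split.
  apply/cvg_mxP => i j; rewrite /stacked !mxE.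
  under eq_fun do rewrite !mxE.
  case: (fintype.split i) => k; first exact: ((cvg_mxP _ _).1 thD.2).
  rewrite !mxE; under eq_fun do rewrite !mxE.
  case: (fintype.split k) => l; first exact: ((cvg_mxP _ _).1 nuD.2).
  exact: ((cvg_mxP _ _).1 wD.2).
move=> t t0; have [th' nu' w'] := sol t t0.
rewrite tangent_mx_stacked.
apply: is_derive_col_mx; first by rewrite -th'; exact: derivable_oy_is_derive.
apply: is_derive_col_mx.
- have -> : - (invmx (mass net) *m (damping net *m nu t + B *m flow net (th t) (w t)))
      = derive1 nu t.
    by rewrite -mulmxN opprD -nu' mulmxA mulVmx// mul1mx.
  exact: derivable_oy_is_derive.
- have -> : tau^-1 *: (invmx W *m C *m K *m S *m flow net (th t) (w t))
      = derive1 w t.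
    by rewrite -w' scalerA mulVf ?scale1r// gt_eqF.
  exact: derivable_oy_is_derive.
Qed.

Lemma stacked_tangent_solution tau (x : R -> 'cV[R]_(n + (n + m))) :
  network_ok net -> 0 < tau -> solves_at_pos (tangent_mx net tau S C K) x ->
  tangent_solution net tau S C K (fun t => usubmx (x t))
    (fun t => usubmx (dsubmx (x t))) (fun t => dsubmx (dsubmx (x t))).
Proof.
move=> ok tau0 [x0 xD].
have Mu : mass net \in unitmx by apply: pos_diag_unit; case: ok => _ _ [].
set th := fun t => _; set nu := fun t => _; set w := fun t => _.
have xE t : x t = stacked (th t) (nu t) (w t) by rewrite /stacked !vsubmxK.
have xD' (t : R) : 0 < t -> is_derive t 1 x
    (stacked (nu t)
      (- (invmx (mass net) *m (damping net *m nu t + B *m flow net (th t) (w t))))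
      (tau^-1 *: (invmx W *m C *m K *m S *m flow net (th t) (w t)))).
  by move=> t0; rewrite -tangent_mx_stacked -xE; exact: xD.
have usubD k l (y : R -> 'cV[R]_(k + l)) dy1 dy2 (t : R) :
    is_derive t 1 y (col_mx dy1 dy2) ->
    is_derive t 1 (fun t => usubmx (y t)) dy1 /\
    is_derive t 1 (fun t => dsubmx (y t)) dy2.
  move=> /is_derive_mxP yD; split; apply/is_derive_mxP => i j.
  - have := yD (lshift l i) j; rewrite col_mxEu; congr (is_derive _ _ _ _).
    by apply/funext => s; rewrite mxE.
  - have := yD (rshift k i) j; rewrite col_mxEd; congr (is_derive _ _ _ _).
    by apply/funext => s; rewrite mxE.
have usub0 k l (y : R -> 'cV[R]_(k + l)) : y t @[t --> 0^'+] --> y 0 ->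
    usubmx (y t) @[t --> 0^'+] --> usubmx (y 0) /\
    dsubmx (y t) @[t --> 0^'+] --> dsubmx (y 0).
  move=> /cvg_mxP y0; split; apply/cvg_mxP => i j; rewrite mxE;
    under eq_fun do rewrite mxE; exact: y0.
have [th0 /usub0[nu0 w0]] := usub0 _ _ _ x0.
have D (t : R) : 0 < t -> [/\ is_derive t 1 th (nu t),
    is_derive t 1 nu
      (- (invmx (mass net) *m (damping net *m nu t + B *m flow net (th t) (w t)))) &
    is_derive t 1 w
      (tau^-1 *: (invmx W *m C *m K *m S *m flow net (th t) (w t)))].
  by move=> /xD' /usubD[? /usubD[]].
split.
- by apply: is_derive_derivable_oy th0 _ => t /D[h _ _]; exact: h.
- by apply: is_derive_derivable_oy nu0 _ => t /D[_ h _]; exact: h.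
- by apply: is_derive_derivable_oy w0 _ => t /D[_ _ h]; exact: h.
move=> t /D[/is_derive_derivable1[_ ->] /is_derive_derivable1[_ ->]
  /is_derive_derivable1[_ ->]]; split=> //.
- by rewrite mulmxN mulmxA mulmxV// mul1mx opprD.
- by rewrite scalerA mulfV ?scale1r// gt_eqF.
Qed.

Lemma flow_derivable_oy th w :
  derivable_oy_Rcontinuous th 0 -> derivable_oy_Rcontinuous w 0 ->
  derivable_oy_Rcontinuous (fun t => flow net (th t) (w t)) 0.
Proof.
by move=> thD wD; apply: derivable_oyD; apply: derivable_oy_mulmx.
Qed.

Lemma harmonic_equation H tau kappa th nu w :
  network_ok net -> harmonic_basis net H -> 0 < tau ->
  tuned_gain net H S C kappa K ->
  tangent_solution net tau S C K th nu w ->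
  let r (t : R) := flow net (th t) (w t) in
  let h (t : R) := harmonic_coord net H (r t) in
  derivable_oy_Rcontinuous h 0
  /\ forall t : R, 0 < t ->
       tau *: derive1 h t = - kappa *: h t + cut_forcing net H S C K (r t).
Proof.
move=> ok Hb tau0 tg [thD nuD wD sol] r h; have Wu := Wop_unit ok.
have hE : h = fun t => H^T *m w t.
  by apply/funext => t; rewrite /h /r harmonic_coord_flow.
split; first by rewrite hE; exact: derivable_oy_mulmx.
move=> t t0; rewrite -harmonic_split//.
have [_ _ w'] := sol t t0.
have [_ ->] : derivable h t 1 /\ derive1 h t = H^T *m derive1 w t.
  rewrite hE; apply: is_derive_derivable1; apply: is_derive_mulmx.
  exact: derivable_oy_is_derive.
by rewrite scalemxAr w' /L_H !mulmxA.
Qed.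

Lemma harmonic_duhamel H tau kappa th nu w :
  network_ok net -> harmonic_basis net H -> 0 < tau ->
  tuned_gain net H S C kappa K ->
  tangent_solution net tau S C K th nu w ->
  let r (t : R) := flow net (th t) (w t) in
  let h (t : R) := harmonic_coord net H (r t) in
  forall t : R, 0 <= t -> forall i,
    h t i 0 = expR (- (kappa / tau) * t) * h 0 i 0
      + tau^-1 * \int[lebesgue_measure]_(s in `[0, t])
          (expR (- (kappa / tau) * (t - s)) * cut_forcing net H S C K (r s) i 0).
Proof.
move=> ok Hb tau0 tg sol r h t t0 i; have Wu := Wop_unit ok.
have [hD hE] := harmonic_equation ok Hb tau0 tg sol.
apply: (variation_of_constants (h := fun t => h t i 0)
  (g := fun s => cut_forcing net H S C K (r s) i 0)) t0.
- by rewrite gt_eqF.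
- exact: (derivable_oy_entry i hD).2.
- move=> s s0.
  have /is_derive_mxP/(_ i 0) := derivable_oy_is_derive hD s0.
  move=> dh; apply: (is_derive_eq dh).
  have /matrixP/(_ i 0) := hE s s0; rewrite !mxE => <-.
  by rewrite mulKf// gt_eqF.
- apply: derivable_oy_Rcontinuous_within_itvcy.
  rewrite (_ : (fun s => _)
    = (fun s => (L_H net H S C K *m (P_C net H *m r s)) i 0)); last first.
    by apply/funext => s; rewrite cut_forcingE.
  apply: derivable_oy_entry; apply: derivable_oy_mulmx; apply: derivable_oy_mulmx.
  by case: sol => thD _ wD _; exact: flow_derivable_oy.
Qed.

Lemma harmonic_law_of_L_HC0 H tau kappa :
  network_ok net -> harmonic_basis net H -> 0 < tau ->
  tuned_gain net H S C kappa K ->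
  L_HC net H S C K = 0 -> harmonic_law net tau H S C K kappa.
Proof.
move=> ok Hb tau0 tg L0 th nu w sol t t0; apply/matrixP => i j.
rewrite ord1 (harmonic_duhamel ok Hb tau0 tg sol t0 i) [RHS]mxE.
under eq_Rintegral do rewrite /cut_forcing L0 lfunE/= mxE mulr0.
by rewrite Rintegral_cst//= mul0r mulr0 addr0.
Qed.

(** Comparing the harmonic equation with the derivative of the exponential law
    shows that the cut forcing vanishes for positive times, hence at time 0 by
    continuity. At time 0 every vector of the cut space is the flow of a state
    with a suitable phase and with zero velocity and actuator components. *)
Lemma L_HC0_of_harmonic_law H tau kappa :
  network_ok net -> harmonic_basis net H -> 0 < tau ->
  tuned_gain net H S C kappa K ->
  harmonic_law net tau H S C K kappa -> L_HC net H S C K = 0.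
Proof.
move=> ok Hb tau0 tg law; have Wu := Wop_unit ok.
apply/lfunP => -[v vcut]; rewrite zero_lfunE lfunE/=.
have /mem_im_mx[y vE] := vcut.
have [x [x0 xD]] := linear_flow_exists (tangent_mx net tau S C K) (stacked y 0 0).
have xsol : solves_at_pos (tangent_mx net tau S C K) x.
  split=> [|t _]; last exact: xD.
  by apply: cvg_at_right_filter; exact: is_derive_continuous (xD 0).
have sol := stacked_tangent_solution ok tau0 xsol.
set th := (X in tangent_solution _ _ _ _ _ X _ _) in sol.
set w := (X in tangent_solution _ _ _ _ _ _ _ X) in sol.
have [hD hE] := harmonic_equation ok Hb tau0 tg sol.
have lawE := law _ _ _ sol.
set r := (fun t => flow net (th t) (w t)).
set h := (fun t => harmonic_coord net H (r t)) in hD.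
have cf0 (t : R) : 0 < t -> cut_forcing net H S C K (r t) = 0.
  move=> t0.
  have h' : derive1 h t = - (kappa / tau) *: h t.
    have eD : is_derive t 1 (fun s => expR (- (kappa / tau) * s) *: h 0)
        (- (kappa / tau) *: h t).
      apply/is_derive_mxP => i j; rewrite ord1.
      have eD := is_deriveZ (h 0 i 0) (is_derive_expR_scale (- (kappa / tau)) t).
      rewrite (_ : (fun s => _) = h 0 i 0 \*: (fun s => expR (- (kappa / tau) * s))).
        apply: (is_derive_eq eD); rewrite [RHS]mxE /h/= /r (lawE t (ltW t0)).
        by rewrite [in RHS]mxE /GRing.scale/= mulrC mulrA.
      by apply/funext => s; rewrite mxE /= /GRing.scale/= mulrC.
    rewrite derive1E -(@derive_val _ _ _ _ _ _ _ eD).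
    apply: near_eq_derive.
    near=> s; rewrite /h /r lawE//.
    by apply: ltW; near: s; exact: lt_nbhsr.
  have := hE t t0; rewrite -/(h t) h'.
  rewrite scalerA mulrN mulrCA mulfV ?gt_eqF// mulr1.
  by rewrite -[LHS]addr0 => /addrI.
have rD : derivable_oy_Rcontinuous r 0.
  by case: sol => thD _ wD _; exact: flow_derivable_oy.
have r0 : r 0 = v.
  rewrite /r /th /w x0 /stacked !col_mxKu !col_mxKd.
  by rewrite /flow mulmx0 addr0.
have : L_H net H S C K *m (P_C net H *m r 0) = 0.
  apply: (@cvg_unique _ (@norm_hausdorff _ _)
    (L_H net H S C K *m (P_C net H *m r t) @[t --> 0^'+])).
    by do 2 apply: cvg_mulmx; exact: rD.2.
  apply: cvg_near_cst; near=> t; rewrite -cut_forcingE//; apply: cf0.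
  by near: t; exact: nbhs_right_gt.
by rewrite r0 P_C_id.
Unshelve. all: by end_near. Qed.

End channels.
End dynamics.

(** * Reduced dynamics *)

Section reduction.
Context {R : realType} {n m : nat} (net : network R n m).
Local Notation B := (incidence net).
Local Notation W := (Wop net).

Lemma enormE k (x : 'cV[R]_k) : enorm x = Num.sqrt (sqn x).
Proof. by []. Qed.

Lemma phase_norm_le (th : 'cV[R]_n) c :
  phase_norm th <= Num.sqrt (sqn (th - c *: const_mx 1)).
Proof.
apply: ge_inf; last by exists c.
by exists 0 => _ [d _ <-]; exact: sqrtr_ge0.
Qed.

Lemma le_phase_norm (th : 'cV[R]_n) a :
  (forall c, a <= Num.sqrt (sqn (th - c *: const_mx 1))) -> a <= phase_norm th.
Proof.
move=> h; apply: lb_le_inf; first by exists (enorm (th - 0 *: const_mx 1)), 0.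
by move=> _ [c _ <-]; exact: h.
Qed.

Lemma phase_norm_ge0 (th : 'cV[R]_n) : 0 <= phase_norm th.
Proof. by apply: le_phase_norm => c; exact: sqrtr_ge0. Qed.

Lemma phase_sqn_le (th : 'cV[R]_n) c :
  phase_norm th ^+ 2 <= sqn (th - c *: const_mx 1).
Proof.
rewrite -[leRHS]sqr_sqrtr ?sqn_ge0// ler_sqr ?nnegrE ?sqrtr_ge0 ?phase_norm_ge0//.
exact: phase_norm_le.
Qed.

Lemma le_phase_sqn (th : 'cV[R]_n) a :
  (forall c, a <= sqn (th - c *: const_mx 1)) -> a <= phase_norm th ^+ 2.
Proof.
move=> h; have [a0|a0] := leP a 0; first exact: le_trans a0 (sqr_ge0 _).
rewrite -[leLHS](sqr_sqrtr (ltW a0)) ler_sqr ?nnegrE ?sqrtr_ge0 ?phase_norm_ge0//.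
by apply: le_phase_norm => c; exact: ler_wsqrtr.
Qed.

Definition reduced_sqn (th nu : 'cV[R]_n) (w : 'cV[R]_m) : R :=
  phase_norm th ^+ 2 + sqn nu + sqn w.

Lemma reduced_normE th nu w : reduced_norm th nu w = Num.sqrt (reduced_sqn th nu w).
Proof. by rewrite /reduced_norm !enormE !sqr_sqrtr ?sqn_ge0. Qed.

Lemma stacked_shift th nu w c :
  stacked th nu w - c *: uniform_shift
  = stacked (th - c *: const_mx 1) nu w :> 'cV[R]_(n + (n + m)).
Proof.
rewrite /stacked /uniform_shift scale_col_mx opp_col_mx add_col_mx.
by rewrite scaler0 subr0.
Qed.

(** A linear map killing the uniform shift descends to the quotient, where the
    norm of the phase is an infimum over shifts. *)
Lemma sqn_mulmx_le_reduced k (F : 'M[R]_(k, n + (n + m))) :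
  F *m uniform_shift = 0 ->
  exists2 c : R, 0 < c & forall th nu w,
    sqn (F *m stacked th nu w) <= c * reduced_sqn th nu w.
Proof.
move=> F0; have [c c0 cF] := sqn_mulmx_le F.
have c1 : 0 < c + 1 by rewrite ltr_wpDl.
exists (c + 1) => // th nu w; rewrite -ler_pdivrMl//.
rewrite /reduced_sqn -addrA -lerBlDr; apply: le_phase_sqn => d.
rewrite lerBlDr ler_pdivrMl//.
have -> : F *m stacked th nu w = F *m (stacked th nu w - d *: uniform_shift).
  by rewrite mulmxBr -scalemxAr F0 scaler0 subr0.
apply: le_trans (cF _) _; rewrite stacked_shift /stacked !sqn_col_mx.
by rewrite ler_wpM2r ?lerDl// !addr_ge0 ?sqn_ge0.
Qed.

Section channels.
Context {ns na : nat} (S : 'M[R]_(ns, m)) (C : 'M[R]_(m, na)) (K : 'M[R]_(na, ns)).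

Lemma uniform_shift_restricted : in_restricted net C uniform_shift.
Proof.
rewrite /in_restricted /uniform_shift col_mxKd.
by apply/mem_im_mx; exists 0; rewrite mulmx0; apply/matrixP => i j; rewrite !mxE.
Qed.

Lemma reduced_coordinates_shift N (Phi : 'M[R]_(N, n + (n + m))) :
  reduced_coordinates net C Phi -> Phi *m uniform_shift = 0.
Proof.
move=> [_ ker]; apply/(ker _ uniform_shift_restricted).
by exists 1; rewrite scale1r.
Qed.

(** Restricted lifts of the basis vectors are the columns of a section [Psi].
    Then [x - Psi (Phi x)] is restricted and has zero coordinates, so it is a
    multiple of the uniform shift. *)
Lemma reduced_section N (Phi : 'M[R]_(N, n + (n + m))) :
  reduced_coordinates net C Phi ->
  exists Psi : 'M[R]_(n + (n + m), N), forall x, in_restricted net C x ->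
    exists c, x - c *: uniform_shift = Psi *m (Phi *m x).
Proof.
move=> [onto ker].
have lift j : exists x : 'cV[R]_(n + (n + m)) * 'cV[R]_na,
    dsubmx (dsubmx x.1) = invmx W *m C *m x.2 /\ Phi *m x.1 = delta_mx j 0.
  have [x /mem_im_mx[y xy] Px] := onto (delta_mx j 0).
  by exists (x, y).
have [f fP] := choice lift.
pose Psi := \matrix_(i, j) (f j).1 i 0; pose Y := \matrix_(i, j) (f j).2 i 0.
have PsiY : dsubmx (dsubmx Psi) = invmx W *m C *m Y.
  apply/matrixP => i j; rewrite !mxE.
  have /matrixP/(_ i 0) := (fP j).1; rewrite !mxE => ->.
  by apply: eq_bigr => k _; rewrite [Y k j]mxE.
have PhiPsi : Phi *m Psi = 1%:M.
  apply/matrixP => i j; have /matrixP/(_ i 0) := (fP j).2; rewrite !mxE !eqxx andbT => <-.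
  by apply: eq_bigr => k _; rewrite mxE.
exists Psi => x /mem_im_mx[y xy].
have /ker : in_restricted net C (x - Psi *m (Phi *m x)).
  apply/mem_im_mx; exists (y - Y *m (Phi *m x)).
  rewrite mulmxBr -xy (mulmxA _ Y) -PsiY.
  by apply/matrixP => i j; rewrite !mxE; congr (_ - _); apply: eq_bigr => k _; rewrite !mxE.
rewrite mulmxBr (mulmxA Phi Psi) PhiPsi mul1mx subrr => -[/(_ erefl)[c xc] _].
by exists c; rewrite -xc subKr.
Qed.

Lemma reduced_sqn_le N (Phi : 'M[R]_(N, n + (n + m))) :
  reduced_coordinates net C Phi ->
  exists2 c : R, 0 <= c & forall th nu w, w \in actuator_space net C ->
    reduced_sqn th nu w <= c * sqn (Phi *m stacked th nu w).
Proof.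
move=> /reduced_section[Psi PsiP]; have [c c0 cPsi] := sqn_mulmx_le Psi.
exists c => // th nu w wC.
have [|d dP] := PsiP (stacked th nu w).
  by rewrite /in_restricted /stacked !col_mxKd.
apply: le_trans (cPsi _); rewrite -dP stacked_shift /stacked !sqn_col_mx.
by rewrite /reduced_sqn -addrA lerD2r phase_sqn_le.
Qed.

Lemma reduced_trajectory_solves tau N (Phi : 'M[R]_(N, n + (n + m))) A th nu w :
  network_ok net -> 0 < tau -> reduced_matrix net tau S C K Phi A ->
  reduced_trajectory net tau S C K th nu w ->
  solves_at_pos A (fun t => Phi *m stacked (th t) (nu t) (w t)).
Proof.
move=> ok tau0 AP [sol wC].
have [x0 xD] := tangent_solution_stacked ok tau0 sol.
split=> [|t t0]; first exact: cvg_mulmx.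
rewrite AP; last by rewrite /in_restricted /stacked !col_mxKd wC// ltW.
by apply: is_derive_mulmx; exact: xD.
Qed.

(** The reduced norm and the norm of the coordinates are equivalent, and the
    coordinates obey a stable linear system. *)
Lemma reduced_decay tau N (Phi : 'M[R]_(N, n + (n + m))) A :
  network_ok net -> 0 < tau -> reduced_coordinates net C Phi ->
  reduced_matrix net tau S C K Phi A -> spectral_abscissa A < 0 ->
  exists c mu : R, [/\ 0 <= c, 0 < mu & forall th nu w,
    reduced_trajectory net tau S C K th nu w -> forall t : R, 0 <= t ->
    reduced_sqn (th t) (nu t) (w t)
    <= c * expR (- mu * t) * reduced_sqn (th 0) (nu 0) (w 0)].
Proof.
move=> ok tau0 PhiP AP sA.
have [c [mu [c0 mu0 cA]]] := stable_decay sA.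
have [c1 c10 c1P] := sqn_mulmx_le_reduced (reduced_coordinates_shift PhiP).
have [c2 c20 c2P] := reduced_sqn_le PhiP.
exists (c2 * (c * c1)), mu; split=> //; first by rewrite !mulr_ge0// ltW.
move=> th nu w traj t t0.
have wC : w t \in actuator_space net C by case: traj => _; apply.
apply: le_trans (c2P _ _ _ wC) _; rewrite -!mulrA ler_wpM2l//.
apply: le_trans (cA _ (reduced_trajectory_solves ok tau0 AP traj) t t0) _.
rewrite -mulrA ler_wpM2l// [leRHS]mulrCA ler_wpM2l ?expR_ge0//.
Qed.

(** Each column of the incidence matrix sums to zero. *)
Lemma uniform_shift_flow : row_mx (W *m B^T) (row_mx 0 W) *m uniform_shift = 0
  :> 'cV[R]_m.
Proof.
rewrite /uniform_shift mul_row_col mulmx0 addr0 -mulmxA.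
suff -> : B^T *m const_mx 1 = 0 :> 'cV[R]_m by rewrite mulmx0.
apply/matrixP => e j; rewrite !mxE.
under eq_bigr do rewrite !mxE mulr1.
rewrite big_split/= sumrN.
rewrite (bigD1 (edge_tail net e))//= eqxx big1 => [|i /negPf->//].
by rewrite (bigD1 (edge_head net e))//= eqxx big1 => [|i /negPf->//]; rewrite !addr0 subrr.
Qed.

Lemma flow_stacked th nu w :
  flow net th w = row_mx (W *m B^T) (row_mx 0 W) *m stacked th nu w.
Proof. by rewrite /flow /stacked !mul_row_col mul0mx add0r. Qed.

Lemma reduced_convergence tau N (Phi : 'M[R]_(N, n + (n + m))) A th nu w :
  network_ok net -> 0 < tau -> reduced_coordinates net C Phi ->
  reduced_matrix net tau S C K Phi A -> spectral_abscissa A < 0 ->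
  reduced_trajectory net tau S C K th nu w ->
  [/\ phase_norm (th t) @[t --> +oo] --> (0 : R),
      nu t @[t --> +oo] --> (0 : 'cV[R]_n),
      w t @[t --> +oo] --> (0 : 'cV[R]_m)
    & flow net (th t) (w t) @[t --> +oo] --> (0 : 'cV[R]_m)].
Proof.
move=> ok tau0 PhiP AP sA traj.
have [c [mu [c0 mu0 cP]]] := reduced_decay ok tau0 PhiP AP sA.
set X0 := reduced_sqn (th 0) (nu 0) (w 0).
have le t : 0 <= t -> reduced_sqn (th t) (nu t) (w t) <= (c * X0) * expR (- mu * t).
  by move=> t0; rewrite mulrAC; exact: cP.
split.
(* the phase norm is handled as a vector with one entry *)
- have /cvg_mxP/(_ 0 0) : const_mx (phase_norm (th t)) @[t --> +oo] --> (0 : 'cV[R]_1).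
    apply: (cvg_sqn_expR mu0) => t t0; apply: le_trans (le t t0).
    by rewrite /sqn big_ord1 mxE /reduced_sqn -addrA lerDl addr_ge0 ?sqn_ge0.
  by rewrite mxE; under eq_fun do rewrite mxE.
- apply: (cvg_sqn_expR mu0) => t t0; apply: le_trans (le t t0).
  by rewrite /reduced_sqn addrAC lerDr addr_ge0 ?sqr_ge0 ?sqn_ge0.
- apply: (cvg_sqn_expR mu0) => t t0; apply: le_trans (le t t0).
  by rewrite /reduced_sqn lerDr addr_ge0 ?sqr_ge0 ?sqn_ge0.
- have [d d0 dP] := sqn_mulmx_le_reduced uniform_shift_flow.
  apply: (cvg_sqn_expR (c := d * (c * X0)) mu0) => t t0.
  rewrite (flow_stacked _ (nu t)); apply: le_trans (dP _ _ _) _.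
  by rewrite -mulrA ler_pM2l// le.
Qed.

Lemma reduced_norm_decay tau N (Phi : 'M[R]_(N, n + (n + m))) A :
  network_ok net -> 0 < tau -> reduced_coordinates net C Phi ->
  reduced_matrix net tau S C K Phi A -> spectral_abscissa A < 0 ->
  exists M0 mu : R, [/\ 1 <= M0, 0 < mu & forall th nu w,
    reduced_trajectory net tau S C K th nu w -> forall t : R, 0 <= t ->
    reduced_norm (th t) (nu t) (w t)
    <= M0 * expR (- mu * t) * reduced_norm (th 0) (nu 0) (w 0)].
Proof.
move=> ok tau0 PhiP AP sA.
have [c [mu [c0 mu0 cP]]] := reduced_decay ok tau0 PhiP AP sA.
have s0 := sqrtr_ge0 c.
(* the decay is known for squared norms, hence the halved rate *)
exists (1 + Num.sqrt c), (mu / 2); split; [by rewrite lerDl|by rewrite divr_gt0|].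
move=> th nu w traj t t0; rewrite !reduced_normE.
apply: le_trans (ler_wsqrtr (cP _ _ _ traj t t0)) _.
have -> : expR (- mu * t) = expR (- (mu / 2) * t) ^+ 2.
  by rewrite -expRM_natl; congr expR; field.
rewrite sqrtrM ?mulr_ge0 ?sqr_ge0// sqrtrM// sqrtr_sqr ger0_norm ?expR_ge0//.
by rewrite ler_wpM2r ?sqrtr_ge0// ler_wpM2r ?expR_ge0// lerDr.
Qed.

End channels.
End reduction.

(** * A triangle on which the harmonic law fails *)

Section triangle.
Context {R : realType}.

(** Absent rows and entries are read as 0, so short lists describe matrices
    with few nonzero entries. *)
Definition list_mx (k l : nat) (rows : seq (seq R)) : 'M[R]_(k, l) :=
  \matrix_(i, j) (nth [::] rows i)`_j.

Definition list_cv (k : nat) (s : seq R) : 'cV[R]_k := \col_i s`_i.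

Ltac mx_compute :=
  rewrite ?(mxE, big_ord_recl, big_ord0) /=.

Lemma cv3E (x : 'cV[R]_3) : exists a b c, x = list_cv 3 [:: a; b; c].
Proof.
exists (x 0 0), (x 1 0), (x (1 + 1) 0); apply/matrixP => i j; rewrite ord1 mxE.
by case: i => [[|[|[|//]]] hi] /=; congr (x _ _); apply: val_inj.
Qed.

Lemma list_mx3_mul k (rows : seq (seq R)) a b c :
  list_mx k 3 rows *m list_cv 3 [:: a; b; c]
  = list_cv k (mkseq (fun i => (nth [::] rows i)`_0 * a + (nth [::] rows i)`_1 * b
                              + (nth [::] rows i)`_2 * c) k).
Proof.
apply/matrixP => i j; mx_compute.
by rewrite nth_mkseq// addr0 addrA.
Qed.

Lemma list_cvD3 a b c a' b' c' :
  list_cv 3 [:: a; b; c] + list_cv 3 [:: a'; b'; c']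
  = list_cv 3 [:: a + a'; b + b'; c + c'].
Proof.
by apply/matrixP => i j; mx_compute; case: i => [[|[|[|//]]] hi].
Qed.

Lemma list_cvZ3 k a b c :
  k *: list_cv 3 [:: a; b; c] = list_cv 3 [:: k * a; k * b; k * c].
Proof.
by apply/matrixP => i j; mx_compute; case: i => [[|[|[|//]]] hi].
Qed.

(** With damping 4, and as long as [w] is a circulation, each phase difference
    obeys [d'' = - 4 d' - 3 d], whose characteristic roots -1 and -3 are
    rational. *)
Definition triangle : network R 3 3 :=
  {| edge_tail := id; edge_head := fun e => ordS e;
     mass := 1%:M; damping := 4%:M; line_coef := fun=> 1;
     theta_op := 0; u_op := 0 |}.

Lemma incidence_triangle :
  incidence triangle = list_mx 3 3 [:: [:: 1; 0; -1]; [:: -1; 1; 0]; [:: 0; -1; 1]].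
Proof.
apply/matrixP => i j; rewrite !mxE -!val_eqE /=.
case: i => [[|[|[|//]]] hi]; case: j => [[|[|[|//]]] hj] /=;
  by rewrite /= ?subr0 ?sub0r.
Qed.

Lemma pr0 : pr (0 : R) = 0.
Proof.
have p0 : 0 < pi :> R := pi_gt0 R.
rewrite /pr add0r (_ : Num.floor _ = 0) ?mulr0z ?mul0r ?subrr ?oppr0//.
have p2 : 0 < pi *+ 2 :> R by rewrite pmulrn_lgt0.
apply: floor_def; rewrite !add0r ler_pdivlMr// ltr_pdivrMr// mul0r (ltW p0)/=.
by rewrite mul1r mulr2n ltrDl.
Qed.

Lemma eta_triangle : eta_op triangle = 0.
Proof. by rewrite /eta_op /= mulmx0 addr0. Qed.

Lemma Wop_triangle : Wop triangle = 1%:M.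
Proof.
rewrite /Wop eta_triangle -diag_const_mx; congr diag_mx.
by apply/matrixP => i j; rewrite !mxE pr0 cos0 mulr1.
Qed.

Lemma triangle_ok : network_ok triangle.
Proof.
split.
- by case=> [[|[|[|//]]] hi]; rewrite -val_eqE.
- split=> // x y.
  have [->|/eqP xy] := eqVneq x y; first exact: connect0.
  apply: connect1; apply/existsP.
  have [yx|] := eqVneq (ordS x) y; first by exists x; rewrite /= eqxx yx eqxx.
  have [<-|] := eqVneq (ordS y) x; first by exists y; rewrite /= !eqxx orbT.
  rewrite -!val_eqE; move: xy.
  case: x => [[|[|[|//]]] hx]; case: y => [[|[|[|//]]] hy] //= xy _ _;
    by case: xy; apply: val_inj.
- by split; split; rewrite ?scalar_mx_is_diag// => i; rewrite mxE eqxx ?mulr1n ?ltr01 ?ltr0n.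
- by move=> e /=; exact: ltr01.
- have p0 : 0 < pi :> R := pi_gt0 R.
  exists (pi / 4); split; [lra|lra|] => e.
  by rewrite eta_triangle mxE pr0 normr0; lra.
Qed.

Lemma triangle_simple : simple_graph triangle.
Proof.
move=> e e' E; apply/eqP; move: E.
move=> /(congr1 (fun A : {set 'I_3} =>
  (0 \in A, 1 \in A, (1 + 1) \in A))) /=.
rewrite !inE -!val_eqE /=.
by case: e => [[|[|[|//]]] he]; case: e' => [[|[|[|//]]] he'].
Qed.

Definition triangle_basis : 'M[R]_(3, 1) := const_mx (Num.sqrt 3)^-1.

Lemma triangle_harmonic_basis :
  harmonic_basis triangle (triangle_basis : 'M[R]_(3, b1 3 3)).
Proof.
suff : basis_of (ker_mx (incidence triangle)) [seq col j triangle_basis | j <- enum 'I_1]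
    /\ triangle_basis^T *m invmx (Wop triangle) *m triangle_basis = 1%:M by [].
have s3 : Num.sqrt 3 != 0 :> R by rewrite gt_eqF// sqrtr_gt0.
split; last first.
  rewrite Wop_triangle invmx1 mulmx1; apply/matrixP => i j; rewrite !ord1.
  mx_compute.
  by rewrite -!expr2 exprVn sqr_sqrtr// addr0; field.
rewrite (_ : enum 'I_1 = [:: 0]); last first.
  by apply: (inj_map val_inj); rewrite val_enum_ord.
rewrite /basis_of span_seq1 seq1_free /=; apply/andP; split; last first.
  apply/eqP => /matrixP/(_ 0 0); rewrite !mxE => /eqP.
  by rewrite invr_eq0 (negPf s3).
rewrite eqEsubv; apply/andP; split.
  rewrite -memvE mem_ker_mx incidence_triangle; apply/eqP/matrixP => i j; mx_compute.
  by case: i => [[|[|[|//]]] hi] /=; ring.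
apply/subvP => x; rewrite mem_ker_mx incidence_triangle => /eqP.
have [a [b [c ->]]] := cv3E x; rewrite list_mx3_mul /= => E.
have /matrixP/(_ 1 0) := E; have /matrixP/(_ (1 + 1) 0) := E; rewrite !mxE /= => E1 E2.
apply/vlineP; exists (a * Num.sqrt 3); apply/matrixP => i j; rewrite !mxE mulfK//.
by case: i => [[|[|[|//]]] hi] /=; lra.
Qed.

(** The single sensor reads the flow on one line, so it also sees the cut
    component. *)
Definition triangle_S : 'M[R]_(1, 3) := list_mx 1 3 [:: [:: 1; 0; 0]].
Definition triangle_C : 'M[R]_(3, 1) := const_mx 1.
Definition triangle_K : 'M[R]_1 := (-1)%:M.

Lemma triangle_gain a b c :
  triangle_C *m triangle_K *m triangle_S *m list_cv 3 [:: a; b; c] = list_cv 3 [:: -a; -a; -a].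
Proof.
rewrite -mulmxA list_mx3_mul /triangle_K mul_mx_scalar; apply/matrixP => i j; mx_compute.
by case: i => [[|[|[|//]]] hi] /=; ring.
Qed.

Lemma triangle_flow a b c a' b' c' :
  flow triangle (list_cv 3 [:: a; b; c]) (list_cv 3 [:: a'; b'; c'])
  = list_cv 3 [:: a - b + a'; b - c + b'; c - a + c'].
Proof.
rewrite /flow Wop_triangle !mul1mx incidence_triangle.
rewrite (_ : (list_mx _ _ _)^T = list_mx 3 3 [:: [:: 1; -1; 0]; [:: 0; 1; -1]; [:: -1; 0; 1]]).
  rewrite list_mx3_mul list_cvD3 /=; congr (list_cv 3 [:: _; _; _]); ring.
apply/matrixP => i j; rewrite !mxE.
by case: i => [[|[|[|//]]] hi]; case: j => [[|[|[|//]]] hj].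
Qed.

Lemma triangle_tangent_mx a b c v0 v1 v2 a' b' c' :
  tangent_mx triangle 1 triangle_S triangle_C triangle_K *m
    stacked (list_cv 3 [:: a; b; c]) (list_cv 3 [:: v0; v1; v2])
      (list_cv 3 [:: a'; b'; c'])
  = let r0 := a - b + a' in let r1 := b - c + b' in let r2 := c - a + c' in
    stacked (list_cv 3 [:: v0; v1; v2])
      (list_cv 3 [:: - 4 * v0 - r0 + r2; - 4 * v1 - r1 + r0; - 4 * v2 - r2 + r1])
      (list_cv 3 [:: - r0; - r0; - r0]).
Proof.
rewrite tangent_mx_stacked Wop_triangle /= !invmx1 !mul1mx triangle_flow triangle_gain.
rewrite invr1 scale1r mul_scalar_mx incidence_triangle list_mx3_mul.
rewrite list_cvZ3 list_cvD3 -scaleN1r list_cvZ3 /=.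
congr (stacked _ (list_cv 3 [:: _; _; _]) _); ring.
Qed.

(** For a phase difference [d] and the velocity difference [e] along the same
    edge, [e + d] and [e + 3 d] decay at the rates 3 and 1. The other two
    coordinates are the sum of the velocities, of rate 4, and the amplitude of
    the circulation produced by the actuator. *)
Definition triangle_Phi : 'M[R]_(6, 3 + (3 + 3)) :=
  row_mx (list_mx 6 3 [:: [:: 1; -1; 0]; [:: 0; 1; -1]; [:: 3; -3; 0]; [:: 0; 3; -3]])
  (row_mx (list_mx 6 3 [:: [:: 1; -1; 0]; [:: 0; 1; -1]; [:: 1; -1; 0]; [:: 0; 1; -1];
                          [:: 1; 1; 1]])
          (list_mx 6 3 [:: [::]; [::]; [::]; [::]; [::]; [:: 1; 0; 0]])).

(** Triangular in these coordinates: the sensor feeds the first phase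
    difference into the actuator equation, in the last row. *)
Definition triangle_A : 'M[R]_6 :=
  list_mx 6 6 [:: [:: -3]; [:: 0; -3]; [:: 0; 0; -1]; [:: 0; 0; 0; -1];
                  [:: 0; 0; 0; 0; -4]; [:: 2^-1; 0; - 2^-1; 0; 0; -1]].

Lemma triangle_Phi_stacked a b c v0 v1 v2 a' b' c' :
  triangle_Phi *m stacked (list_cv 3 [:: a; b; c]) (list_cv 3 [:: v0; v1; v2])
      (list_cv 3 [:: a'; b'; c'])
  = list_cv 6 [:: v0 - v1 + (a - b); v1 - v2 + (b - c); v0 - v1 + 3 * (a - b);
                 v1 - v2 + 3 * (b - c); v0 + v1 + v2; a'].
Proof.
rewrite /triangle_Phi /stacked !mul_row_col !list_mx3_mul /=.
apply/matrixP => i j; rewrite !mxE.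
by case: i => [[|[|[|[|[|[|//]]]]]] hi] /=; ring.
Qed.

Lemma triangle_restricted (x : 'cV[R]_(3 + (3 + 3))) :
  in_restricted triangle triangle_C x <->
  exists a b c v0 v1 v2 y, x = stacked (list_cv 3 [:: a; b; c])
    (list_cv 3 [:: v0; v1; v2]) (list_cv 3 [:: y; y; y]).
Proof.
have CE (z : 'cV[R]_1) : invmx (Wop triangle) *m triangle_C *m z
    = list_cv 3 [:: z 0 0; z 0 0; z 0 0].
  rewrite Wop_triangle invmx1 mul1mx; apply/matrixP => i j; rewrite ord1; mx_compute.
  by case: i => [[|[|[|//]]] hi] /=; rewrite mul1r addr0.
split=> [/mem_im_mx[z xz]|[a [b [c [v0 [v1 [v2 [y ->]]]]]]]].
  have [a [b [c thE]]] := cv3E (usubmx x).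
  have [v0 [v1 [v2 nuE]]] := cv3E (usubmx (dsubmx x)).
  exists a, b, c, v0, v1, v2, (z 0 0).
  by rewrite /stacked -thE -nuE -CE -xz !vsubmxK.
apply/mem_im_mx; exists (const_mx y).
by rewrite /stacked !col_mxKd CE mxE.
Qed.

Lemma triangle_reduced_coordinates : reduced_coordinates triangle triangle_C triangle_Phi.
Proof.
split=> [z|x /triangle_restricted[a [b [c [v0 [v1 [v2 [y ->]]]]]]]].
(* solving for the differences d, e along two edges, then for the velocities
   from their sum; the phase of the last vertex is normalized to 0 *)
- pose z' i := z (inord i) 0.
  pose d1 := (z' 2 - z' 0) / 2; pose d2 := (z' 3 - z' 1) / 2.
  pose e1 := (3 * z' 0 - z' 2) / 2; pose e2 := (3 * z' 1 - z' 3) / 2.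
  pose v2 := (z' 4 - e1 - 2 * e2) / 3.
  exists (stacked (list_cv 3 [:: d1 + d2; d2; 0])
    (list_cv 3 [:: v2 + e2 + e1; v2 + e2; v2]) (list_cv 3 [:: z' 5; z' 5; z' 5])).
    apply/triangle_restricted.
    by exists (d1 + d2), d2, 0, (v2 + e2 + e1), (v2 + e2), v2, (z' 5).
  rewrite triangle_Phi_stacked; apply/matrixP => i j; rewrite ord1 mxE.
  have -> : z i 0 = z' i by rewrite /z' inord_val.
  by case: i => [[|[|[|[|[|[|//]]]]]] hi] /=; rewrite /v2 /d1 /d2 /e1 /e2; field.
- have shiftE : uniform_shift = stacked (list_cv 3 [:: 1; 1; 1])
      (list_cv 3 [:: 0; 0; 0]) (list_cv 3 [:: 0; 0; 0]) :> 'cV[R]_(3 + (3 + 3)).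
    rewrite /uniform_shift -[0 in LHS]col_mx0 /stacked.
    by congr (col_mx _ (col_mx _ _)); apply/matrixP => i j; rewrite !mxE;
      case: i => [[|[|[|//]]] hi].
  split=> [|[k ->]]; last first.
    rewrite -scalemxAr shiftE triangle_Phi_stacked; apply/matrixP => i j; rewrite !mxE.
    by case: i => [[|[|[|[|[|[|//]]]]]] hi] /=; ring.
  rewrite triangle_Phi_stacked => E.
  have e i (hi : (i < 6)%N) := congr1 (fun X : 'cV[R]_6 => X (Ordinal hi) 0) E.
  have := e 0 isT; have := e 1 isT; have := e 2 isT; have := e 3 isT.
  have := e 4 isT; have := e 5 isT; rewrite !mxE /= => y0 s0 f3 f2 f1 f0.
  exists c; rewrite shiftE /stacked !scale_col_mx !list_cvZ3.
  by congr (col_mx (list_cv 3 [:: _; _; _])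
    (col_mx (list_cv 3 [:: _; _; _]) (list_cv 3 [:: _; _; _]))); lra.
Qed.

Lemma triangle_reduced_matrix :
  reduced_matrix triangle 1 triangle_S triangle_C triangle_K triangle_Phi triangle_A.
Proof.
move=> x /triangle_restricted[a [b [c [v0 [v1 [v2 [y ->]]]]]]].
rewrite triangle_tangent_mx /= !triangle_Phi_stacked.
apply/matrixP => i j; mx_compute.
by case: i => [[|[|[|[|[|[|//]]]]]] hi] /=; field.
Qed.

Lemma triangle_stable : spectral_abscissa triangle_A < 0.
Proof.
have eigE z : eigenvalue (map_mx (real_complex R) triangle_A) z <->
    exists i, z = real_complex R (triangle_A i i).
  rewrite eigenvalue_root_char char_poly_trig; last first.
    apply/is_trig_mxP => i j ij; rewrite !mxE.
    by move: ij; case: i => [[|[|[|[|[|[|//]]]]]] hi];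
      case: j => [[|[|[|[|[|[|//]]]]]] hj].
  rewrite /root horner_prod; split=> [/prodf_eq0[i _]|[i ->]].
    by rewrite !hornerE subr_eq0 => /eqP ->; exists i; rewrite mxE.
  by apply/prodf_eq0; exists i => //; rewrite !hornerE [X in _ - X]mxE subrr.
have diag i : triangle_A i i <= -1.
  by rewrite mxE; case: i => [[|[|[|[|[|[|//]]]]]] hi] /=; lra.
apply: (@le_lt_trans _ _ (-1)); last by rewrite ltrN10.
apply: ge_sup => [|_ [z /eigE[i ->] <-]]; last exact: diag.
by exists (triangle_A 0 0), (real_complex R (triangle_A 0 0)) => //; apply/eigE; exists 0.
Qed.

(** An eigenvector of the tangent system for the eigenvalue -3, with a nonzero
    circulation. *)
Definition triangle_x0 : 'cV[R]_(3 + (3 + 3)) :=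
  stacked (list_cv 3 [:: 1; -1; 0]) (list_cv 3 [:: -3; 3; 0]) (list_cv 3 [:: 1; 1; 1]).

Definition triangle_x (t : R) : 'cV[R]_(3 + (3 + 3)) := expR (-3 * t) *: triangle_x0.

Lemma triangle_x_solves :
  solves_at_pos (tangent_mx triangle 1 triangle_S triangle_C triangle_K) triangle_x.
Proof.
have Tx0 : tangent_mx triangle 1 triangle_S triangle_C triangle_K *m triangle_x0 = -3 *: triangle_x0.
  rewrite /triangle_x0 triangle_tangent_mx /stacked !scale_col_mx !list_cvZ3 /=.
  by congr (col_mx (list_cv 3 [:: _; _; _])
    (col_mx (list_cv 3 [:: _; _; _]) (list_cv 3 [:: _; _; _]))); ring.
have xD (t : R) :
    is_derive t 1 triangle_x (tangent_mx triangle 1 triangle_S triangle_C triangle_K *m triangle_x t).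
  have -> : tangent_mx triangle 1 triangle_S triangle_C triangle_K *m triangle_x t = -3 *: triangle_x t.
    by rewrite /triangle_x -scalemxAr Tx0 !scalerA [in LHS]mulrC.
  apply/is_derive_mxP => i j.
  have eD := is_deriveZ (triangle_x0 i j) (is_derive_expR_scale (-3) t).
  rewrite (_ : (fun s => _) = triangle_x0 i j \*: (fun s => expR (-3 * s))).
    apply: (is_derive_eq eD); rewrite [RHS]mxE /triangle_x [X in _ = _ * X]mxE.
    by rewrite /GRing.scale/= mulrC mulrA.
  by apply/funext => s; rewrite mxE /GRing.scale/= mulrC.
by split=> [|t _//]; apply: cvg_at_right_filter; exact: is_derive_continuous (xD 0).
Qed.

Lemma triangle_trajectory :
  reduced_trajectory triangle 1 triangle_S triangle_C triangle_K (fun t => usubmx (triangle_x t))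
    (fun t => usubmx (dsubmx (triangle_x t))) (fun t => dsubmx (dsubmx (triangle_x t))).
Proof.
split; first exact: stacked_tangent_solution triangle_ok ltr01 triangle_x_solves.
move=> t _; suff : in_restricted triangle triangle_C (triangle_x t) by [].
apply/triangle_restricted.
rewrite /triangle_x /triangle_x0 /stacked !scale_col_mx !list_cvZ3.
set e := expR _.
by exists (e * 1), (e * -1), (e * 0), (e * -3), (e * 3), (e * 0), (e * 1).
Qed.

Lemma triangle_rank_S : \rank (triangle_S *m triangle_basis) = 1%N.
Proof.
rewrite rank_rV (_ : _ != 0)//; apply/eqP => /matrixP/(_ 0 0); mx_compute.
rewrite mul1r !mul0r !addr0 => /eqP; apply/negP.
by rewrite invr_eq0 sqrtr_eq0 -ltNge ltr0n.
Qed.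

Lemma triangle_rank_C :
  \rank (triangle_basis^T *m invmx (Wop triangle) *m triangle_C) = 1%N.
Proof.
rewrite Wop_triangle invmx1 mulmx1.
rewrite rank_rV (_ : _ != 0)//; apply/eqP => /matrixP/(_ 0 0); mx_compute.
have s0 : 0 < (Num.sqrt 3)^-1 :> R by rewrite invr_gt0 sqrtr_gt0.
lra.
Qed.

Lemma triangle_tuned :
  tuned_gain triangle (triangle_basis : 'M[R]_(3, b1 3 3)) triangle_S triangle_C 1 triangle_K.
Proof.
suff : triangle_basis^T *m invmx (Wop triangle) *m triangle_C *m triangle_K *m triangle_S
    *m triangle_basis
  = - 1 *: 1%:M by [].
have HE : triangle_basis
    = list_cv 3 [:: (Num.sqrt 3)^-1; (Num.sqrt 3)^-1; (Num.sqrt 3)^-1].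
  by apply/matrixP => i j; rewrite !mxE; case: i => [[|[|[|//]]] hi].
rewrite Wop_triangle invmx1 mulmx1.
have -> : triangle_basis^T *m triangle_C *m triangle_K *m triangle_S *m triangle_basis
    = triangle_basis^T *m (triangle_C *m triangle_K *m triangle_S *m triangle_basis).
  by rewrite !mulmxA.
rewrite HE triangle_gain; apply/matrixP => i j; rewrite !ord1; mx_compute.
have s3 : (Num.sqrt 3)^-1 ^+ 2 = 3^-1 :> R by rewrite exprVn sqr_sqrtr.
move: s3; set s := _^-1 => s3.
transitivity (-3 * s ^+ 2); first by ring.
by rewrite s3; field.
Qed.

Lemma triangle_no_law : exists t : R, 0 < t /\
  harmonic_coord triangle (triangle_basis : 'M[R]_(3, b1 3 3))
    (flow triangle (usubmx (triangle_x t)) (dsubmx (dsubmx (triangle_x t))))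
  <> expR (- (1 / 1) * t)
    *: harmonic_coord triangle (triangle_basis : 'M[R]_(3, b1 3 3))
    (flow triangle (usubmx (triangle_x 0)) (dsubmx (dsubmx (triangle_x 0)))).
Proof.
exists 1; split=> //.
rewrite !(harmonic_coord_flow _ _ (Wop_unit triangle_ok) triangle_harmonic_basis).
have wE t : dsubmx (dsubmx (triangle_x t)) = expR (-3 * t) *: list_cv 3 [:: 1; 1; 1].
  by rewrite /triangle_x /triangle_x0 /stacked !scale_col_mx !col_mxKd.
rewrite !wE -!scalemxAr scalerA mulr0 expR0 mulr1 divr1 !mulr1.
move=> /(@congr1 _ _ (fun X : 'M[R]_1 => X 0 0)).
have s0 : 0 < (Num.sqrt 3)^-1 :> R by rewrite invr_gt0 sqrtr_gt0.
mx_compute.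
rewrite !mulr1 addr0 => /eqP; rewrite -subr_eq0 -mulrBl mulf_eq0 subr_eq0.
have -> : ((Num.sqrt 3)^-1 + ((Num.sqrt 3)^-1 + (Num.sqrt 3)^-1) == 0 :> R) = false.
  by apply/negbTE; lra.
by rewrite orbF => /eqP/expR_inj; lra.
Qed.

End triangle.

(** * The corollary *)

Theorem corollary12p7 (R : realType) :
  (forall (n m ns na : nat) (net : network R n m) (H : 'M[R]_(m, b1 n m))
      (tau : R) (S : 'M[R]_(ns, m)) (C : 'M[R]_(m, na)),
    network_ok net ->
    harmonic_basis net H ->
    0 < tau ->
    \rank (S *m H) = b1 n m ->
    \rank (H^T *m invmx (Wop net) *m C) = b1 n m ->
    forall kappa : R, 0 < kappa ->
    [/\ exists K : 'M[R]_(na, ns), tuned_gain net H S C kappa K,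
        (* the minimal square case *)
        forall (ena : na = b1 n m) (ens : ns = b1 n m) (K : 'M[R]_(na, ns)),
          tuned_gain net H S C kappa K <->
          K = castmx (esym ena, esym ens)
            (- kappa *:
              (invmx (castmx (erefl, ena) (H^T *m invmx (Wop net) *m C))
               *m invmx (castmx (ens, erefl) (S *m H))))
      & forall K : 'M[R]_(na, ns), tuned_gain net H S C kappa K ->
        [/\ (* the harmonic equation *)
            forall (th nu : R -> 'cV[R]_n) (w : R -> 'cV[R]_m),
              tangent_solution net tau S C K th nu w ->
              let r (t : R) := flow net (th t) (w t) in
              let h (t : R) := harmonic_coord net H (r t) in
              derivable_oy_Rcontinuous h 0
              /\ forall t : R, 0 < t ->
                   P_C net H *m r t \in cut_space net
                   /\ tau *: derive1 h t
                      = - kappa *: h t + cut_forcing net H S C K (r t),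
            (* (i) *)
            [/\ harmonic_law net tau H S C K kappa <-> L_HC net H S C K = 0,
                L_HC net H S C K = 0 <->
                  H^T *m invmx (Wop net) *m C *m K *m S *m P_C net H = 0
              & S *m P_C net H = 0 -> harmonic_law net tau H S C K kappa]
          & (* (ii) *)
            forall (N : nat) (Phi : 'M[R]_(N, n + (n + m))) (A : 'M[R]_N),
              reduced_coordinates net C Phi ->
              reduced_matrix net tau S C K Phi A ->
              spectral_abscissa A < 0 ->
              (exists M0 mu : R, [/\ 1 <= M0, 0 < mu &
                forall (th nu : R -> 'cV[R]_n) (w : R -> 'cV[R]_m),
                  reduced_trajectory net tau S C K th nu w ->
                  forall t : R, 0 <= t ->
                    reduced_norm (th t) (nu t) (w t)
                    <= M0 * expR (- mu * t)
                       * reduced_norm (th 0) (nu 0) (w 0)])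
              /\ forall (th nu : R -> 'cV[R]_n) (w : R -> 'cV[R]_m),
                   reduced_trajectory net tau S C K th nu w ->
                   let r (t : R) := flow net (th t) (w t) in
                   let h (t : R) := harmonic_coord net H (r t) in
                   [/\ [/\ phase_norm (th t) @[t --> +oo] --> (0 : R),
                           nu t @[t --> +oo] --> (0 : 'cV[R]_n)
                         & w t @[t --> +oo] --> (0 : 'cV[R]_m)],
                       [/\ r t @[t --> +oo] --> (0 : 'cV[R]_m),
                           P_C net H *m r t @[t --> +oo] --> (0 : 'cV[R]_m)
                         & h t @[t --> +oo] --> (0 : 'cV[R]_(b1 n m))]
                     & forall t : R, 0 <= t -> forall i,
                         h t i 0
                         = expR (- (kappa / tau) * t) * h 0 i 0
                           + tau^-1 * \int[lebesgue_measure]_(s in `[0, t])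
                               (expR (- (kappa / tau) * (t - s))
                                * cut_forcing net H S C K (r s) i 0)]]])
  /\
  (* a stable instance in which h does not follow the exponential law *)
  (exists (n m ns na : nat) (net : network R n m) (H : 'M[R]_(m, b1 n m))
      (tau : R) (S : 'M[R]_(ns, m)) (C : 'M[R]_(m, na))
      (kappa : R) (K : 'M[R]_(na, ns))
      (N : nat) (Phi : 'M[R]_(N, n + (n + m))) (A : 'M[R]_N)
      (th nu : R -> 'cV[R]_n) (w : R -> 'cV[R]_m) (t : R),
    [/\ [/\ network_ok net, simple_graph net, harmonic_basis net H & 0 < tau],
        [/\ \rank (S *m H) = b1 n m,
            \rank (H^T *m invmx (Wop net) *m C) = b1 n m,
            0 < kappa & tuned_gain net H S C kappa K],
        [/\ reduced_coordinates net C Phi,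
            reduced_matrix net tau S C K Phi A
          & spectral_abscissa A < 0],
        reduced_trajectory net tau S C K th nu w
      & 0 < t /\
        harmonic_coord net H (flow net (th t) (w t))
        <> expR (- (kappa / tau) * t)
           *: harmonic_coord net H (flow net (th 0) (w 0))]).
Proof.
split=> [n m ns na net H tau S C ok Hb tau0 rS rC kappa kappa0|]; last first.
  have [t [t0 nolaw]] := @triangle_no_law R.
  exists 3, 3, 1, 1, triangle, (triangle_basis : 'M[R]_(3, b1 3 3)), 1, triangle_S,
    triangle_C, 1, triangle_K.
  exists 6, triangle_Phi, triangle_A, (fun t => usubmx (triangle_x t)),
    (fun t => usubmx (dsubmx (triangle_x t))), (fun t => dsubmx (dsubmx (triangle_x t))), t.
  split.
  - split; [exact: triangle_ok|exact: triangle_simple| |exact: ltr01].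
    exact: triangle_harmonic_basis.
  - split; [exact: triangle_rank_S|exact: triangle_rank_C|exact: ltr01|exact: triangle_tuned].
  - split; [exact: triangle_reduced_coordinates| |exact: triangle_stable].
    exact: triangle_reduced_matrix.
  - exact: triangle_trajectory.
  - by split.
have Wu := Wop_unit ok.
split.
- exact: tuned_gain_exists.
- move=> ena ens K; subst na ns; rewrite !castmx_id.
  exact: tuned_gain_square.
move=> K tg; split.
- move=> th nu w sol r h.
  have [hD hE] := harmonic_equation ok Hb tau0 tg sol.
  by split=> // t t0; split; [exact: P_C_cut|exact: hE].
- have law := harmonic_law_of_L_HC0 ok Hb tau0 tg.
  split; first by split; [exact: L_HC0_of_harmonic_law|exact: law].
    exact: L_HC_eq0.
  move=> SP; apply: law; apply/(L_HC_eq0 _ _ _ Wu Hb).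
  by rewrite /L_H -mulmxA SP mulmx0.
move=> N Phi A PhiP AP sA; split; first exact: reduced_norm_decay AP sA.
move=> th nu w traj r h.
have [ph0 nu0 w0 r0] := reduced_convergence ok tau0 PhiP AP sA traj.
split; first by split.
- split=> //.
    by rewrite -(mulmx0 _ (P_C net H)); exact: cvg_mulmx.
  by rewrite -(mulmx0 _ (H^T *m invmx (Wop net))); exact: cvg_mulmx.
- exact: harmonic_duhamel traj.1.
Qed.
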